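(* Let $r$ be a positive integer, let $q$ be a complex number with $0<|q|<1$, let $a,b,z$ be complex numbers (with $z\ne0$, $az\neq1$) such that $\max(|az|,|b|)<1$, and let $x_1,\dots,x_r$ be nonzero, pairwise distinct complex numbers. For $\mathbf k=(k_1,\dots,k_r)\in\mathbb Z^r$ write $|\mathbf k|=k_1+\dots+k_r$. Then \[ \frac{(zq,1/z)_{\infty}}{1-az} \prod_{i,j=1}^{r}\Big(\frac{x_i}{x_j}q\Big)_{\infty} =\sum _{k_1,\dots,k_r=-\infty}^{\infty}\Bigg( \prod_{1\le i<j\le r}\frac {x_iq^{k_i}-x_jq^{k_j}}{x_i-x_j}\, \big(aq^{-|\mathbf k|}+b\big)_{\infty}\, \big(zq(a+bq^{|\mathbf k|})\big)_{\infty} (-1)^{r|\mathbf k|}q^{|\mathbf k|+r\sum_{i=1} ^{r}\binom{k_i}2} z^{|\mathbf k|}\prod_{i=1}^{r}x_i^{rk_i-|\mathbf k|} \Bigg). \]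
   Context: For a complex number $x$, $(x)_\infty=(x;q)_\infty:=\prod_{j\ge0}(1-xq^j)$, and $(x_1,\dots,x_m)_\infty:=(x_1)_\infty\cdots(x_m)_\infty$. Here $(aq^{-|\mathbf k|}+b)_\infty$ means $\prod_{j\ge0}(1-(aq^{-|\mathbf k|}+b)q^j)$, and similarly for $(zq(a+bq^{|\mathbf k|}))_\infty$. *)

(* Defs.v *)
From HB Require Import structures.
From mathcomp Require Export all_boot all_order all_algebra.
From mathcomp Require Export finmap complex.
From mathcomp Require Export boolp classical_sets reals topology normedtype.
From mathcomp Require Export summability.

Set Implicit Arguments.
Unset Strict Implicit.
Unset Printing Implicit Defensive.

Import Order.TTheory GRing.Theory Num.Theory.
Import numFieldNormedType.Exports.

Local Open Scope classical_set_scope.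
Local Open Scope ring_scope.

(* R[i] carries no canonical topology of its own. The analytic notions are
   stated over a numFieldType K, whose topology is that of its norm, and are
   used at K := R[i], where this is the usual topology of the complex plane. *)

Definition qpoch_inf (K : numFieldType) (q x : K) : K :=
  lim ((fun n : nat => \prod_(0 <= j < n) (1 - x * q ^+ j)) @ \oo).

(* Convergence along the net of finite subsets of I, i.e. independent of any
   ordering of I; over R[i] this amounts to absolute convergence. *)
Definition has_sum (K : numFieldType) (I : choiceType) (f : I -> K) (s : K) :
    Prop :=
  partial_sum f @ totally --> s.

Definition zsum (r : nat) (k : {ffun 'I_r -> int}) : int := \sum_i k i.

(* n (n - 1) is even and nonnegative for every n, so the division is exact for
   negative n as well. *)
Definition zbin2 (n : int) : int := ((n * (n - 1)) %/ 2)%Z.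

(* Main.v *)
(** The sum is the limit of a terminating one, so that a single use of Tannery's theorem gives both its summability
    and its value.

    The terminating identity combines two finite sums. The first is a
    q-Rothe summation in [z]: the difference of its two sides satisfies
    [E(qz) = q^N E(z)] by induction on the length [N], and vanishes at
    [z = 1/(a + b q^N)], where only the last term survives; hence it has the
    infinitely many zeros [q^m / (a + b q^N)].
    The second is a terminating form of the Macdonald identity of type A: in
    the sum over [0 <= k_i <= m] with [|k| = n], Lagrange interpolation at the
    points [x_i q^(k_i)] gives a two-term recurrence in [n], so this sum is a
    multiple of the q-binomial coefficient of [r m] and [n], which is the
    weight of the [n]-th term of the q-Rothe sum.
    Shifting [k] by [-N] with [m = 2 N] and letting [N] tend to infinity yields
    the theorem when no quotient [x_i / x_j] is a power of [q]. If
    [x_j = x_i q^m], exchanging [x_i q^(k_i)] with [x_j q^(k_j)] is an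
    involution of the index set that changes the sign of the summand, and both
    sides vanish. *)

Require Import Defs.
From mathcomp Require Import ring lra zify sequences exp perm.

Set Implicit Arguments.
Unset Strict Implicit.
Unset Printing Implicit Defensive.

Import Order.TTheory GRing.Theory Num.Theory.
Import numFieldNormedType.Exports.

Local Open Scope classical_set_scope.
Local Open Scope ring_scope.

(** The factor [1 / (1 - a z)] comes from a corrected Pochhammer symbol, [rothe_rest], in the
    terminating sum: its limit is that of the plain symbol times [1 - a z]. The substitutions
    [a q^L], [z / q^L] and [x i / q^N] made before the limit keep [a z] and all ratios [x i / x j]
    fixed. The delicate point is domination. The monomial and the Pochhammer symbols cannot be
    estimated separately: the symbol of [a q^(-n) + b], with [n = |k|], may grow like an inverse
    Gaussian as [n] tends to plus infinity, and that of [z q (a + b q^n)] as [n] tends to minus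
    infinity. Only their product with [q^(n(n+1)/2) z^n] decays, geometrically with ratios [|a z|]
    and [|b|], and this has to be shown uniformly in the truncation level. In the differences
    [k i - k j] the decay is Gaussian. The majorant is therefore geometric in [|k|] and in [r - 1]
    differences. The terminating identity divides by finite Pochhammer symbols of [q x i / x j],
    which is why it is confined to generic [x]. *)

(** * Polynomial functions and their zeros *)

Section PolynomialFunctions.
Variable K : fieldType.

(** A property closed under sums and products, so that the polynomials in [z] and in [a] behind the
    q-Rothe sum never have to be written out. *)
Definition polyfun (f : K -> K) := exists p : {poly K}, forall x, f x = p.[x].

Lemma polyfun_cst c : polyfun (fun=> c).
Proof. by exists c%:P => x; rewrite hornerC. Qed.

Lemma polyfun_id : polyfun id.
Proof. by exists 'X => x; rewrite hornerX. Qed.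

Lemma polyfunD f g : polyfun f -> polyfun g -> polyfun (fun x => f x + g x).
Proof. by case=> p hp [s hs]; exists (p + s) => x; rewrite hornerD hp hs. Qed.

Lemma polyfunM f g : polyfun f -> polyfun g -> polyfun (fun x => f x * g x).
Proof. by case=> p hp [s hs]; exists (p * s) => x; rewrite hornerM hp hs. Qed.

Lemma polyfunB f g : polyfun f -> polyfun g -> polyfun (fun x => f x - g x).
Proof. by case=> p hp [s hs]; exists (p - s) => x; rewrite !hornerE hp hs. Qed.

Lemma polyfunX f n : polyfun f -> polyfun (fun x => f x ^+ n).
Proof. by case=> p hp; exists (p ^+ n) => x; rewrite horner_exp hp. Qed.

Lemma polyfun_sum n (F : 'I_n -> K -> K) : (forall i, polyfun (F i)) ->
  polyfun (fun x => \sum_(i < n) F i x).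
Proof.
elim: n F => [|n IH] F hF.
  by case: (polyfun_cst 0) => p hp; exists p => x; rewrite big_ord0.
have [p hp] := IH _ (fun i => hF (lift ord0 i)); have [s hs] := hF ord0.
by exists (s + p) => x; rewrite big_ord_recl hornerD hs -hp.
Qed.

Lemma polyfun_prod n (F : 'I_n -> K -> K) : (forall i, polyfun (F i)) ->
  polyfun (fun x => \prod_(i < n) F i x).
Proof.
elim: n F => [|n IH] F hF.
  by case: (polyfun_cst 1) => p hp; exists p => x; rewrite big_ord0.
have [p hp] := IH _ (fun i => hF (lift ord0 i)); have [s hs] := hF ord0.
by exists (s * p) => x; rewrite big_ord_recl hornerM hs -hp.
Qed.

Lemma polyfun_eq0 f (u : nat -> K) : polyfun f -> injective u ->
  (forall n, f (u n) = 0) -> forall x, f x = 0.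
Proof.
case=> p hp inju fu x.
suff p0 : p = 0 by rewrite hp p0 horner0.
apply/eqP/negPn/negP => p0.
have /(max_poly_roots p0) : all (root p) [seq u i | i <- iota 0 (size p)].
  by apply/allP => y /mapP[i _ ->]; rewrite /root -hp fu.
by rewrite (map_inj_uniq inju) iota_uniq size_map size_iota ltnn => /(_ isT).
Qed.
End PolynomialFunctions.

(** * The terminating q-Rothe summation *)

Section QRothe.
Variables (K : fieldType) (q : K).
Hypothesis q0 : q != 0.
Hypothesis qX : forall n, q ^+ n.+1 != 1.

Definition qpoch (x : K) n := \prod_(j < n) (1 - x * q ^+ j).

Lemma qpoch0 x : qpoch x 0 = 1. Proof. by rewrite /qpoch big_ord0. Qed.

Lemma qpochS x n : qpoch x n.+1 = qpoch x n * (1 - x * q ^+ n).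
Proof. by rewrite /qpoch big_ord_recr. Qed.

Lemma qpochSl x n : qpoch x n.+1 = (1 - x) * qpoch (x * q) n.
Proof.
rewrite /qpoch big_ord_recl /= expr0 mulr1; congr (_ * _).
by apply: eq_bigr => i _; rewrite /bump /= add1n exprS mulrA.
Qed.

Lemma qpochD x m n : qpoch x (m + n) = qpoch x m * qpoch (x * q ^+ m) n.
Proof.
elim: n => [|n IH]; first by rewrite addn0 qpoch0 mulr1.
by rewrite addnS !qpochS IH -!mulrA exprD.
Qed.

Lemma qfact_neq0 n : qpoch q n != 0.
Proof.
by apply/prodf_neq0 => i _; rewrite -exprS subr_eq0 eq_sym qX.
Qed.

Lemma expq_inj : injective (fun n : nat => q ^+ n).
Proof.
move=> m n; wlog: m n / (m <= n)%N => [H|le_mn] /= e.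
  by case/orP: (leq_total m n) => /H; [|move/(_ (esym e))]; auto.
move: e; rewrite -(subnKC le_mn) exprD -[LHS]mulr1.
move/(mulfI (expf_neq0 m q0)).
case: (n - m)%N => [|d] /eqP; first by rewrite addn0.
by rewrite eq_sym (negPf (qX d)).
Qed.

(** Up to a sign and a power of [q], the Pochhammer symbol of [(a + b q^k) / q^k] of length [k],
    written without division so as to be polynomial in [a]. *)
Definition rothe_base (a b : K) k := \prod_(j < k) (a + b * q ^+ k - q ^+ j.+1).

Definition rothe_term a b N z k :=
  z ^+ k * rothe_base a b k * qpoch (z * q * (a + b * q ^+ k)) (N - k)
  / (qpoch q k * qpoch q (N - k)).

Definition rothe_sum a b N z := \sum_(k < N.+1) rothe_term a b N z k.

(** With [y = z q (a + b q^k)], both Pochhammer symbols contain that of [q y] of length [N - k]. The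
    cofactors [1 - y q^(N-k+1)] and [q^(N-k+1) (1 - y)] differ by [1 - q^(N-k+1)], which cancels
    against the denominator. *)
Lemma rothe_term_shift a b N z k : (k <= N)%N ->
  rothe_term a b N.+1 (q * z) k - q ^+ N.+1 * rothe_term a b N.+1 z k =
  rothe_term a b N (q * z) k.
Proof.
move=> kN; rewrite /rothe_term subSn // [qpoch q _.+1]qpochS.
rewrite [qpoch (q * z * q * _) _.+1]qpochS [qpoch (z * q * _) _.+1]qpochSl.
have -> : z * q * (a + b * q ^+ k) * q = q * z * q * (a + b * q ^+ k) by ring.
set P := qpoch _ (N - k); set B := rothe_base a b k.
have -> : q ^+ N.+1 = q * q ^+ (N - k) * q ^+ k.
  by rewrite -mulrA -exprD subnK // exprS.
rewrite exprMn.
have h1 := qfact_neq0 k; have h2 := qfact_neq0 (N - k).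
have h3 : 1 - q * q ^+ (N - k) != 0.
  by have := qfact_neq0 (N - k).+1; rewrite qpochS mulf_eq0 => /norP[].
field; by rewrite h1 h2 h3.
Qed.

(** The term [k = N + 1] is a constant times [z^(N+1)] and drops out of the difference; all others
    shift one by one. *)
Lemma rothe_sum_shift a b N z :
  rothe_sum a b N.+1 (q * z) - q ^+ N.+1 * rothe_sum a b N.+1 z =
  rothe_sum a b N (q * z).
Proof.
rewrite {1 2}/rothe_sum !(@big_ord_recr _ _ _ N.+1) /= mulrDr opprD.
rewrite addrACA mulr_sumr -sumrB.
rewrite (eq_bigr (fun k : 'I_N.+1 => rothe_term a b N (q * z) k)) => [|i _].
  by rewrite -/(rothe_sum _ _ _ _) /rothe_term subnn !qpoch0 exprMn; ring.
by rewrite rothe_term_shift // -ltnS.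
Qed.

(* [1 - z (a + b q^N) = (1 - z q^(N-k) (a + b q^k)) - z a (1 - q^(N-k))] makes
   this the term of the q-Rothe sum even for [k = N]. *)
Definition rothe_rest a b N z k :=
  qpoch (z * q * (a + b * q ^+ k)) (N - k)
  - z * a * (1 - q ^+ (N - k)) * qpoch (z * q * (a + b * q ^+ k)) (N - k).-1.

Definition qrothe a b N z :=
  \sum_(k < N.+1) z ^+ k * rothe_base a b k * rothe_rest a b N z k
    / (qpoch q k * qpoch q (N - k)).

Lemma rothe_restE a b N z k : (k < N)%N ->
  rothe_rest a b N z k =
  (1 - z * (a + b * q ^+ N)) * qpoch (z * q * (a + b * q ^+ k)) (N - k).-1.
Proof.
move=> kN; rewrite /rothe_rest -(prednK (n := N - k)) ?subn_gt0 //.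
set m := (N - k).-1; rewrite [m.+1.-1]/= qpochS.
have -> : q ^+ N = q ^+ m.+1 * q ^+ k.
  by rewrite -exprD /m prednK ?subn_gt0 // subnK // ltnW.
rewrite exprS; ring.
Qed.

(** Cancelling [1 - q^(N+1-k)] against the denominator turns the correction in [rothe_rest] into a
    term of the sum of length [N]. In this way [qrothe] inherits the functional equation of
    [rothe_sum]. *)
Lemma qrotheE a b N z :
  qrothe a b N.+1 z = rothe_sum a b N.+1 z - z * a * rothe_sum a b N z.
Proof.
rewrite /qrothe {1}/rothe_sum !(@big_ord_recr _ _ _ N.+1) /=.
rewrite addrAC /rothe_sum mulr_sumr -sumrB; congr (_ + _); last first.
  by rewrite /rothe_rest /rothe_term subnn expr0 subrr mulr0 mul0r subr0.
apply: eq_bigr => i _; have iN : (i <= N)%N by rewrite -ltnS.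
rewrite /rothe_rest /rothe_term subSn //= [qpoch q _.+1]qpochS -exprS.
have h1 := qfact_neq0 i; have h2 := qfact_neq0 (N - i).
have h3 : 1 - q ^+ (N - i).+1 != 0 by rewrite subr_eq0 eq_sym qX.
by field; rewrite h1 h2 h3.
Qed.

Lemma polyfun_qpoch f n : polyfun f -> polyfun (fun z => qpoch (f z) n).
Proof.
move=> hf; apply: polyfun_prod => i.
by apply: polyfunB; [exact: polyfun_cst|apply: polyfunM => //; exact: polyfun_cst].
Qed.

Lemma polyfun_qrothe_z a b N : polyfun (qrothe a b N).
Proof.
have id := polyfun_id; have cst := polyfun_cst.
apply: polyfun_sum => k; apply: polyfunM => //; apply: polyfunM.
  by apply: polyfunM => //; apply: polyfunX.
have h : polyfun (fun z => z * q * (a + b * q ^+ k)).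
  by do 2 apply: polyfunM => //.
apply: polyfunB; first exact: polyfun_qpoch.
apply: polyfunM; last exact: polyfun_qpoch.
by do 2 apply: polyfunM => //.
Qed.

Lemma polyfun_qrothe_a b N z : polyfun (fun a => qrothe a b N z).
Proof.
have id := @polyfun_id K; have cst := @polyfun_cst K.
have h k : polyfun (fun a => a + b * q ^+ k) by apply: polyfunD.
apply: polyfun_sum => k; apply: polyfunM => //; apply: polyfunM.
  apply: polyfunM => //; apply: polyfun_prod => j.
  by apply: polyfunB.
apply: polyfunB; first by apply/polyfun_qpoch/polyfunM.
apply: polyfunM; last by apply/polyfun_qpoch/polyfunM.
by do 2 apply: polyfunM => //.
Qed.

Lemma qrothe_root a b N z : z * (a + b * q ^+ N) = 1 ->
  qrothe a b N z = qpoch (z * q) N / qpoch q N.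
Proof.
move=> hz; rewrite /qrothe big_ord_recr big1 /= => [|i _]; last first.
  by rewrite rothe_restE // hz subrr mul0r mulr0 mul0r.
rewrite add0r subnn qpoch0 mulr1 /rothe_rest subnn qpoch0 subrr.
rewrite mulr0 mul0r subr0 mulr1; congr (_ / _).
have -> : z ^+ N = \prod_(j < N) z by rewrite prodr_const card_ord.
rewrite /rothe_base /qpoch -big_split /=.
by apply: eq_bigr => j _; rewrite mulrBr hz exprS mulrA.
Qed.

Theorem qrothe_sum a b N z : qrothe a b N z = qpoch (z * q) N / qpoch q N.
Proof.
elim: N a z => [|N IH] a z.
  rewrite /qrothe big_ord_recl big_ord0 /rothe_base /rothe_rest !big_ord0.
  by rewrite !qpoch0 expr0 subrr mulr0 mul0r subr0 addr0 !mulr1.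
pose E a z := qrothe a b N.+1 z - qpoch (z * q) N.+1 / qpoch q N.+1.
have Eshift c w : E c (q * w) = q ^+ N.+1 * E c w.
  have key : qrothe c b N.+1 (q * w) - q ^+ N.+1 * qrothe c b N.+1 w =
      qpoch (q * w * q) N / qpoch q N.
    rewrite -(IH c) !qrotheE.
    have -> : rothe_sum c b N.+1 (q * w) =
        q ^+ N.+1 * rothe_sum c b N.+1 w + rothe_sum c b N (q * w).
      by rewrite -(rothe_sum_shift c b N w); ring.
    (* [qrotheE] needs a positive length, so the value [N = 0] of the right-hand side is computed
       directly. *)
    case: (N) => [|n].
      rewrite /qrothe /rothe_sum !big_ord_recl !big_ord0 /= /rothe_term.
      by rewrite /rothe_rest /rothe_base !big_ord0 !qpoch0; ring.
    rewrite qrotheE.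
    have -> : rothe_sum c b n.+1 (q * w) =
        q ^+ n.+1 * rothe_sum c b n.+1 w + rothe_sum c b n (q * w).
      by rewrite -(rothe_sum_shift c b n w); ring.
    by rewrite exprS; ring.
  rewrite /E; move/(canRL (subrK _)): key => ->; rewrite [qpoch q _.+1]qpochS.
  rewrite [qpoch (q * w * q) _.+1]qpochS [qpoch (w * q) _.+1]qpochSl.
  have -> : w * q * q = q * w * q by ring.
  rewrite exprS.
  have h1 := qfact_neq0 N.
  have h3 : 1 - q * q ^+ N != 0 by rewrite -exprS subr_eq0 eq_sym qX.
  by field; rewrite h1 h3.
have Epow c w n : E c (q ^+ n * w) = q ^+ (N.+1 * n) * E c w.
  elim: n => [|n IHn]; first by rewrite muln0 !mul1r.
  by rewrite exprS -mulrA Eshift IHn mulrA -exprD mulnS.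
have id := @polyfun_id K; have cst := @polyfun_cst K.
have Enz c w : c + b * q ^+ N.+1 != 0 -> E c w = 0.
  move=> y0; apply: (@polyfun_eq0 _ _
    (fun n : nat => q ^+ n * (c + b * q ^+ N.+1)^-1)).
  - apply: polyfunB; first exact: polyfun_qrothe_z.
    by apply: polyfunM => //; apply/polyfun_qpoch/polyfunM.
  - by move=> m n /(mulIf (invr_neq0 y0)) /expq_inj.
  - by move=> n; rewrite Epow /E qrothe_root ?subrr ?mulr0 // mulVf.
apply/eqP; rewrite -subr_eq0 -/(E a z); apply/eqP.
(* The zeros in [z] exist only if [a + b q^(N+1)] is nonzero. The remaining value of [a] is reached
   by polynomiality in [a]: at [a = q^n - b q^(N+1)] this quantity is [q^n], so [Enz] applies
   there. *)
apply: (@polyfun_eq0 _ (E^~ z) (fun n : nat => q ^+ n - b * q ^+ N.+1)).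
- by apply: polyfunB => //; apply: polyfun_qrothe_a.
- by move=> m n /addIr /expq_inj.
- by move=> n; apply: Enz; rewrite subrK expf_neq0.
Qed.
End QRothe.

(** * Vandermonde products and a residue identity *)

Section VandermondeProduct.
Variables (K : fieldType) (r : nat).
Implicit Types y c : 'I_r -> K.

Definition vdm y := \prod_(i < r) \prod_(j < r | (i < j)%N) (y i - y j).

Lemma vdmD1 i0 y : vdm y =
  (\prod_(j < r | j != i0) (-1) ^+ (j < i0)%N) *
  \prod_(j < r | j != i0) (y i0 - y j) *
  \prod_(i < r | i != i0) \prod_(j < r | (i < j)%N && (j != i0)) (y i - y j).
Proof.
rewrite /vdm (bigD1 i0) //= [X in X * _](_ : _ = \prod_(j < r | j != i0)
    (if (i0 < j)%N then y i0 - y j else 1)); last first.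
  rewrite -big_mkcondr /=; apply: eq_bigl => j.
  by rewrite -val_eqE /=; case: ltngtP.
rewrite -!big_split /=; apply: eq_bigr => i ii0.
have := ii0; rewrite -val_eqE /= neq_ltn => /orP[] lt_i.
  rewrite ltnNge ltnW // mul1r (bigD1 i0) //= lt_i expr1.
  by congr (_ * _); ring.
by rewrite lt_i ltnNge ltnW //= expr0 mul1r; congr (_ * _);
  apply: eq_bigl => j; rewrite -val_eqE /=; case: (ltngtP i j) => //= ij;
  rewrite gtn_eqF // (ltn_trans lt_i).
Qed.

(** The quotient of [vdm y] by the product of the [y i0 - y j] is independent of [y i0];
    cross-multiplied, this needs no distinctness. *)
Lemma vdm_replace i0 y y' : (forall j, j != i0 -> y' j = y j) ->
  vdm y' * \prod_(j < r | j != i0) (y i0 - y j) =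
  vdm y * \prod_(j < r | j != i0) (y' i0 - y j).
Proof.
move=> yy'; rewrite !(vdmD1 i0).
have -> : \prod_(j < r | j != i0) (y' i0 - y' j) =
    \prod_(j < r | j != i0) (y' i0 - y j).
  by apply: eq_bigr => j ji; rewrite (yy' j).
have -> : \prod_(i < r | i != i0) \prod_(j < r | (i < j)%N && (j != i0)) (y' i - y' j)
    = \prod_(i < r | i != i0) \prod_(j < r | (i < j)%N && (j != i0)) (y i - y j).
  by apply: eq_bigr => i ii0; apply: eq_bigr => j /andP[_ ji0]; rewrite !yy'.
by ring.
Qed.

Lemma vdm_scale (s : K) y : vdm (fun i => s * y i) = s ^+ 'C(r, 2) * vdm y.
Proof.
have -> : vdm (fun i => s * y i) =
    \prod_(i < r) (s ^+ (r - i.+1) * \prod_(j < r | (i < j)%N) (y i - y j)).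
  apply: eq_bigr => i _; rewrite (eq_bigr (fun j => s * (y i - y j))) => [|j _].
    rewrite big_split /= -prodr_const_nat big_geq_mkord //.
  by rewrite mulrBr.
rewrite big_split /=; congr (_ * _).
rewrite prodrXr -triangular_sum big_mkord (reindex_inj rev_ord_inj) /=.
by congr (_ ^+ _); apply: eq_bigr => i _; have := ltn_ord i; lia.
Qed.

Lemma vdm_neq0 y : injective y -> vdm y != 0.
Proof.
move=> inj; apply/prodf_neq0 => i _; apply/prodf_neq0 => j ij.
by rewrite subr_eq0 (inj_eq inj) -val_eqE /= ltn_eqF.
Qed.

(* Sum of the residues of [\prod_j (Y - c_j) / (Y \prod_j (Y - y_j))]. *)
Lemma lagrange_residues y c : injective y -> (forall i, y i != 0) ->
  \sum_(i < r) (\prod_(j < r) (y i - c j)) /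
     (y i * \prod_(j < r | j != i) (y i - y j))
  = 1 - (\prod_j c j) / \prod_j y j.
Proof.
move=> inj y0.
(* A difference of two monic polynomials of degree [r] has degree below [r], so it equals its
   Lagrange interpolant at the [y i]. The claim is this equality at [0], divided by minus the
   product of the [- y j]. *)
pose P := \prod_(j < r) ('X - (c j)%:P) - \prod_(j < r) ('X - (y j)%:P).
pose L i := \prod_(j < r | j != i) ((y i - y j)^-1 *: ('X - (y j)%:P)).
have sP : (size P <= r)%N.
  have sz (d : 'I_r -> K) : size (\prod_(j < r) ('X - (d j)%:P)) = r.+1.
    by rewrite size_prod_XsubC /index_enum -enumT size_enum_ord.
  apply/leq_sizeP => j; rewrite leq_eqVlt => /orP[/eqP <-|rj]; last first.
    by rewrite coefB !nth_default ?subr0 // sz.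
  have co d : (\prod_(j < r) ('X - (d j)%:P))`_r = 1 :> K.
    by have /monicP := monic_prod_XsubC (index_enum 'I_r) xpredT d;
      rewrite lead_coefE sz.
  by rewrite coefB !co subrr.
have sL i : (size (L i) <= r)%N.
  rewrite /L scaler_prod; apply: leq_trans (size_scale_leq _ _) _.
  rewrite -big_filter size_prod_XsubC -(size_map val).
  rewrite size_map -[X in (_ <= X)%N](@prednK r) ?(leq_ltn_trans _ (ltn_ord i)) //.
  rewrite ltnS size_filter -sum1_count sum1_card.
  by rewrite cardC1 card_ord.
have Lii i : (L i).[y i] = 1.
  rewrite horner_prod big1 // => j ji; rewrite !hornerE mulVf // subr_eq0.
  by rewrite (inj_eq inj) eq_sym.
have Lij i j : i != j -> (L i).[y j] = 0.
  by move=> ij; rewrite horner_prod (bigD1 j) 1?eq_sym //= !hornerE subrr mulr0 mul0r.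
have PE : P = \sum_(i < r) P.[y i] *: L i.
  apply/eqP; rewrite -subr_eq0; apply/negPn/negP => nz.
  have := @max_poly_roots _ _ [seq y i | i <- enum 'I_r] nz.
  rewrite (map_inj_uniq inj) enum_uniq size_map size_enum_ord.
  have -> : all (root (P - \sum_(i < r) P.[y i] *: L i)) [seq y i | i <- enum 'I_r].
    apply/allP => _ /mapP[i _ ->]; rewrite /root hornerD hornerN horner_sum.
    rewrite (bigD1 i) //= hornerZ Lii mulr1 big1 ?addr0 ?subrr // => j ji.
    by rewrite hornerZ Lij // mulr0.
  move=> /(_ isT isT); rewrite ltnNge => /negP; apply.
  rewrite (leq_trans (size_polyD _ _)) // size_polyN geq_max sP /=.
  rewrite (leq_trans (size_sum _ _ _)) //; apply/bigmax_leqP => i _.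
  exact: leq_trans (size_scale_leq _ _) (sL i).
have Py i : P.[y i] = \prod_j (y i - c j).
  rewrite /P hornerD hornerN !horner_prod [X in _ - X](bigD1 i) //=.
  by rewrite hornerXsubC subrr mul0r subr0; apply: eq_bigr => j _; rewrite hornerXsubC.
have Y0 : \prod_j y j != 0 by apply/prodf_neq0.
have := congr1 (fun p : {poly K} => p.[0]) PE.
rewrite {1}/P hornerD hornerN !horner_prod horner_sum.
under eq_bigr do rewrite hornerXsubC sub0r.
under [X in _ - X = _]eq_bigr do rewrite hornerXsubC sub0r.
under [RHS]eq_bigr do rewrite hornerZ horner_prod Py.
rewrite !prodrN -mulrBr => /(congr1 (fun t => - t / \prod_j (- y j))).
rewrite prodrN -mulrN opprB; set s := (-1) ^+ _.
have s0 : s != 0 by rewrite signr_eq0.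
rewrite -mulf_div divff // mul1r mulrBl divff // => ->.
rewrite -sumrN mulr_suml; apply: eq_bigr => i _.
rewrite (bigD1 i (P := predT)) //= in Y0 *.
set D := \prod_(j | _) (y i - y j).
have -> : \prod_(j < r | j != i) ((y i - y j)^-1 *: ('X - (y j)%:P)).[0] =
    \prod_(j < r | j != i) ((- y j) / (y i - y j)).
  by apply: eq_bigr => j _; rewrite !hornerE mulrC.
rewrite big_split /= prodfV -/D.
have D0 : D != 0.
  by apply/prodf_neq0 => j ji; rewrite subr_eq0 (inj_eq inj) eq_sym.
have -> : s = - (-1) ^+ #|[pred j | j != i]|.
  have i_gt0 := leq_ltn_trans (leq0n i) (ltn_ord i).
  rewrite /s (eq_card (B := 'I_r)) // card_ord cardC1 card_ord.
  by rewrite -[in LHS](prednK i_gt0) exprS mulN1r.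
rewrite prodrN; set t := (-1) ^+ _.
have t0 : t != 0 by rewrite signr_eq0.
move: Y0; rewrite mulf_eq0 => /norP[_ Y1].
by field; rewrite ?oppr_eq0 ?D0 ?Y1 ?t0 ?y0.
Qed.
End VandermondeProduct.

(** * A terminating form of the Macdonald identity of type A *)

Section TerminatingAr.
Variables (K : fieldType) (q : K).
Hypothesis q0 : q != 0.
Hypothesis qX : forall n, q ^+ n.+1 != 1.
Variables (r m : nat) (x : 'I_r -> K).
Hypothesis x0 : forall i, x i != 0.
Hypothesis xgen : forall i j n, i != j -> x i * q ^+ n != x j.

Lemma gen_factor_neq0 i j n : 1 - x i / x j * q ^+ n.+1 != 0.
Proof.
rewrite subr_eq0 eq_sym; have [->|ij] := eqVneq i j.
  by rewrite divff // mul1r qX.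
by rewrite mulrAC (can2_eq (divfK _) (mulfK _)) // mul1r xgen.
Qed.

Definition ipoch (w : K) n := (qpoch q (w * q) n)^-1.

Lemma gen_qpoch_neq0 i j n : qpoch q (x i / x j * q) n != 0.
Proof.
by apply/prodf_neq0 => l _; rewrite -mulrA -exprS gen_factor_neq0.
Qed.

(** The factor depends on [k] through [k i] alone. The Vandermonde product is then the only coupling
    between coordinates, and a unit step in [k i] changes a single weight. *)
Definition arweight (k : 'I_r -> nat) i :=
  x i ^+ (r * k i) * q ^+ (r * 'C(k i, 2)) *
  \prod_(j < r) (ipoch (x j / x i) (m - k i) * ipoch (x i / x j) (k i)).

Definition arterm (k : 'I_r -> nat) :=
  vdm (fun i => x i * q ^+ k i) * \prod_(i < r) arweight k i.

Definition arden (y : 'I_r -> K) i := y i * \prod_(j < r | j != i) (y i - y j).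

(** The [i]-th residue of [lagrange_residues] with [c j = x j q^n]. It is used for [n = 0] and
    [n = m], where the factor [j = i] vanishes exactly on the faces [k i = 0] and [k i = m] of the
    box, which have no neighbour below, respectively above. *)
Definition arnum (k : 'I_r -> nat) n i :=
  (\prod_(j < r) (x i * q ^+ k i - x j * q ^+ n))
  / arden (fun i => x i * q ^+ k i) i.

Lemma geny_inj (k : 'I_r -> nat) : injective (fun i => x i * q ^+ k i).
Proof.
move=> i j /= e; apply/eqP/negPn/negP => ij; case/orP: (leq_total (k i) (k j)) => le.
  move: e; rewrite -(subnK le) exprD mulrA => /(mulIf (expf_neq0 _ q0)) e.
  by have := @xgen j i (k j - k i)%N; rewrite eq_sym ij e eqxx => /(_ isT).
move: e; rewrite -(subnK le) exprD mulrA => /(mulIf (expf_neq0 _ q0)) e.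
by have := @xgen i j (k i - k j)%N; rewrite ij e eqxx => /(_ isT).
Qed.

Lemma geny_neq0 (k : 'I_r -> nat) i : x i * q ^+ k i != 0.
Proof. by rewrite mulf_neq0 // expf_neq0. Qed.

Lemma sum_arnum k n : \sum_(i < r) arnum k n i =
  1 - q ^+ (r * n) / q ^+ (\sum_i k i).
Proof.
rewrite /arnum /arden lagrange_residues; last 2 first.
- exact: geny_inj.
- exact: geny_neq0.
rewrite !big_split /= prodr_const card_ord prodrXr -exprM mulnC.
by rewrite -mulf_div divff ?mul1r //; apply/prodf_neq0.
Qed.

(** The step produces [r] factors [x i q^(k i)]; each turns some [1 - (x j / x i) q^(m - k i)] into
    [x i q^(k i) - x j q^m]. *)
Lemma arweightS k k' i : k' i = (k i).+1 -> (k i < m)%N ->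
  arweight k' i * \prod_(j < r) (1 - x i * q ^+ (k i).+1 / x j) =
  arweight k i * \prod_(j < r) (x i * q ^+ k i - x j * q ^+ m).
Proof.
move=> k'E km; rewrite /arweight k'E.
have -> : (m - k i)%N = (m - (k i).+1).+1 by lia.
set n := k i; set e := (m - n.+1)%N.
have -> : x i ^+ (r * n.+1) * q ^+ (r * 'C(n.+1, 2)) =
    x i ^+ (r * n) * q ^+ (r * 'C(n, 2)) * \prod_(j < r) (x i * q ^+ n).
  rewrite prodr_const card_ord binS bin1 mulnS mulnDr !exprD exprMn -exprM.
  rewrite [(n * r)%N]mulnC; ring.
rewrite -!mulrA; congr (_ * (_ * _)); rewrite -!big_split /=.
apply: eq_bigr => j _; rewrite /ipoch !qpochS.
have -> : q ^+ m = q ^+ e.+1 * q ^+ n by rewrite -exprD; congr (_ ^+ _); rewrite /e; lia.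
have h1 := gen_qpoch_neq0 j i e; have h2 := gen_qpoch_neq0 i j n.
have h3 := gen_factor_neq0 j i e; have h4 := gen_factor_neq0 i j n.
have := h3; have := h4; rewrite !exprS => h4' h3'.
have xi0 := x0 i; have xj0 := x0 j.
field.
rewrite xi0 xj0 h1 h2 /=.
have -> : x i - x j * q * q ^+ e = x i * (1 - x j / x i * (q * q ^+ e)) by field.
have -> : x j - x i * q * q ^+ n = x j * (1 - x i / x j * (q * q ^+ n)) by field.
by rewrite !mulf_neq0.
Qed.

(* The edges [k -> k + e_i] transport the [i]-th residue at [k] to that at
   [k + e_i]; the residues at [k] sum to a function of [|k|] alone. *)
Lemma arterm_edge k k' i : (forall j, j != i -> k' j = k j) ->
  k' i = (k i).+1 -> (k i < m)%N ->
  arterm k' * arnum k' 0 i * ((-1) ^+ r / \prod_j x j) =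
  q^-1 * (arterm k * arnum k m i).
Proof.
move=> kk' k'i km; rewrite /arterm /arnum /arden.
have yy' j : j != i -> x j * q ^+ k' j = x j * q ^+ k j by move=> /kk' ->.
have := vdm_replace yy'; have := arweightS k'i km.
have -> : \prod_(j < r) arweight k' j =
    arweight k' i * \prod_(j < r | j != i) arweight k j.
  rewrite (bigD1 i) //=; congr (_ * _).
  by apply: eq_bigr => j ji; rewrite /arweight kk'.
have -> : \prod_(j < r) arweight k j =
    arweight k i * \prod_(j < r | j != i) arweight k j by rewrite (bigD1 i).
have -> : \prod_(j < r | j != i) (x i * q ^+ k' i - x j * q ^+ k' j) =
    \prod_(j < r | j != i) (x i * q ^+ k' i - x j * q ^+ k j).
  by apply: eq_bigr => j ji; rewrite (kk' j).
(* The prefactor extracted here is the origin of the normalisation [(-1)^r / \prod_j x j] in the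
   statement; the [q^-1] there comes from the factor [y i] of [arden]. *)
have -> : \prod_j (x i * q ^+ k' i - x j * q ^+ 0) =
    (-1) ^+ r * (\prod_j x j) * \prod_(j < r) (1 - x i * q ^+ (k i).+1 / x j).
  rewrite -[in (-1) ^+ r](card_ord r) -prodr_const -!big_split /=.
  by apply: eq_bigr => j _; rewrite k'i expr0; have xj0 := x0 j; field.
set A := arweight k' i; set A' := arweight k i; set W := \prod_(j | _) arweight _ _.
set V' := vdm _; set V := vdm _; set P := \prod_j (1 - _); set P' := \prod_j (_ - _).
set X := \prod_j x j; set D := \prod_(j < r | _) (x i * q ^+ k i - _).
set D' := \prod_(j < r | _) _.
move=> eA eV.
have X0 : X != 0 by apply/prodf_neq0.
have D0 : D != 0.
  apply/prodf_neq0 => j ji; rewrite subr_eq0 (inj_eq (@geny_inj k)).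
  by rewrite eq_sym.
have D0' : D' != 0.
  apply/prodf_neq0 => j ji; rewrite subr_eq0 -kk' // (inj_eq (@geny_inj k')).
  by rewrite eq_sym.
have s2 : (-1) ^+ r * (-1) ^+ r = 1 :> K
  by rewrite -exprD addnn -mul2n exprM sqrrN expr1n expr1n.
have y0 := geny_neq0 k i; have := y0; rewrite mulf_eq0 => /norP[xi0 qk0].
rewrite k'i exprS.
have eV' : V' = V * D' / D by rewrite -eV mulfK.
have -> : V' * (A * W) * ((-1) ^+ r * X * P / (x i * (q * q ^+ k i) * D')) * ((-1)
  ^+ r / X)
  = (V' / D') * W * (A * P) * ((-1) ^+ r * (-1) ^+ r) / (x i * (q * q ^+ k i)).
  by field; rewrite X0 qk0 q0 xi0 D0'.
rewrite s2 eA eV'.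
by field; rewrite D0 D0' qk0 q0 xi0.
Qed.

Definition kval (k : {ffun 'I_r -> 'I_m.+1}) : 'I_r -> nat := fun i => k i.

Definition ksum (k : {ffun 'I_r -> 'I_m.+1}) : nat := \sum_i k i.

Definition arsum n := \sum_(k : {ffun 'I_r -> 'I_m.+1} | ksum k == n) arterm (kval k).

Definition kincr i (k : {ffun 'I_r -> 'I_m.+1}) : {ffun 'I_r -> 'I_m.+1} :=
  [ffun j => if j == i then inord (k j).+1 else k j].

Definition kdecr i (k : {ffun 'I_r -> 'I_m.+1}) : {ffun 'I_r -> 'I_m.+1} :=
  [ffun j => if j == i then inord (k j).-1 else k j].

Lemma ksumD1 i (k : {ffun 'I_r -> 'I_m.+1}) :
  ksum k = (k i + \sum_(j < r | j != i) k j)%N.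
Proof. by rewrite /ksum (bigD1 i). Qed.

Lemma kincr_sum i (k : {ffun 'I_r -> 'I_m.+1}) : (k i < m)%N -> ksum (kincr i k)
  = (ksum k).+1.
Proof.
move=> km; rewrite !(ksumD1 i) ffunE eqxx inordK // addSn; congr (_ + _).+1.
by apply: eq_bigr => j ji; rewrite ffunE (negPf ji).
Qed.

Lemma kincrK i (k : {ffun 'I_r -> 'I_m.+1}) : (k i < m)%N -> kdecr i (kincr i k) = k.
Proof.
move=> km; apply/ffunP => j; rewrite !ffunE; case: eqP => // ->.
by apply: val_inj; rewrite /= !inordK // ltnW.
Qed.

Lemma kdecrK i (k : {ffun 'I_r -> 'I_m.+1}) : (0 < k i)%N -> kincr i (kdecr i k) = k.
Proof.
move=> km; apply/ffunP => j; rewrite !ffunE; case: eqP => // ->.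
have lt_k := leq_ltn_trans (leq_pred (k i)) (ltn_ord (k i)).
by apply: val_inj; rewrite /= (inordK lt_k) prednK // inordK.
Qed.

(** If [t] is the incremented entry, then [0 < t <= m] and the round trip returns [k i = t - 1]. The
    reindexing by [kincr] thus recovers the range of [k i], whatever [inord] gives beyond it. *)
Lemma kincr_lt i (k : {ffun 'I_r -> 'I_m.+1}) :
  (0 < kincr i k i)%N -> kdecr i (kincr i k) = k -> (k i < m)%N.
Proof.
move=> k0 /(congr1 (fun k : {ffun 'I_r -> 'I_m.+1} => val (k i))).
move: k0; rewrite !ffunE eqxx /= => k0.
have := ltn_ord (inord (k i).+1 : 'I_m.+1); move: k0.
set t := inord _ => k0 tm.
by rewrite inordK => [|]; lia.
Qed.

(** The edges between the levels [n] and [n + 1] are counted from both ends: by [sum_arnum], the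
    residues at an upper end add up to [1 - q^-(n+1)] and those at a lower end to
    [1 - q^(r m - n)]. *)
Lemma arsumS n : (n < r * m)%N ->
  arsum n.+1 * (1 - q ^+ n.+1) =
  (-1) ^+ r.+1 * (\prod_j x j) * q ^+ n * (1 - q ^+ (r * m - n)) * arsum n.
Proof.
move=> nm.
have key : arsum n.+1 * (1 - q ^- n.+1) * ((-1) ^+ r / \prod_j x j) =
    q^-1 * (arsum n * (1 - q ^+ (r * m) / q ^+ n)).
  rewrite /arsum !mulr_suml mulr_sumr.
  rewrite (eq_bigr (fun k : {ffun 'I_r -> 'I_m.+1} => \sum_(i < r)
     (arterm (kval k) * arnum (kval k) 0 i * ((-1) ^+ r / \prod_j x j)))); last first.
    move=> k /eqP kn; rewrite -mulr_suml -mulr_sumr sum_arnum muln0 expr0 mul1r.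
    by rewrite -/(ksum k) kn.
  rewrite [RHS](eq_bigr (fun k : {ffun 'I_r -> 'I_m.+1} => \sum_(i < r)
     (q^-1 * (arterm (kval k) * arnum (kval k) m i)))); last first.
    by move=> k /eqP kn; rewrite -!mulr_sumr sum_arnum -/(ksum k) kn.
  rewrite exchange_big [RHS]exchange_big /=; apply: eq_bigr => i _.
  rewrite (bigID (fun k : {ffun 'I_r -> 'I_m.+1} => 0 < k i)%N) /= addrC big1 ?add0r;
    last first.
    move=> k /andP[_]; rewrite lt0n negbK => /eqP k0.
    by rewrite /arnum (bigD1 i) //= /kval k0 subrr !mul0r mulr0 mul0r.
  rewrite [RHS](bigID (fun k : {ffun 'I_r -> 'I_m.+1}
    => k i < m)%N) /= [RHS]addrC [X in _ = X + _]big1 ?add0r; last first.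
    move=> k /andP[_]; rewrite -leqNgt => mk.
    have ke : k i = m :> nat by apply/eqP; rewrite eqn_leq mk -ltnS ltn_ord.
    by rewrite /arnum (bigD1 i) //= /kval ke subrr !mul0r !mulr0.
  rewrite (reindex_onto (kincr i) (kdecr i)); last by move=> k /andP[_]; exact: kdecrK.
  apply: eq_big => [k|k /andP[/andP[_ k0] /eqP kE]].
    apply/idP/idP.
      move=> /andP[/andP[/eqP kn k0] /eqP kE].
      have km := kincr_lt k0 kE.
      by rewrite km andbT; move: kn; rewrite kincr_sum // => -[->].
    move=> /andP[/eqP kn km]; rewrite kincr_sum // kn eqxx /= kincrK // eqxx andbT.
    by rewrite ffunE eqxx inordK.
  have km := kincr_lt k0 kE.
  rewrite (@arterm_edge (kval k)) // => [j ji|]; rewrite /kval ffunE ?eqxx ?inordK //.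
  by rewrite (negPf ji).
have X0 : \prod_j x j != 0 by apply/prodf_neq0.
have qn0 : q ^+ n != 0 by apply: expf_neq0.
have s2 : (-1) ^+ r * (-1) ^+ r = 1 :> K
  by rewrite -exprD addnn -mul2n exprM sqrrN expr1n expr1n.
have -> : q ^+ (r * m - n) = q ^+ (r * m) / q ^+ n.
  by apply: (canRL (mulfK _)) => //; rewrite -exprD subnK // ltnW.
transitivity (- (arsum n.+1 * (1 - q ^- n.+1) * ((-1) ^+ r / \prod_j x j)) *
   ((-1) ^+ r * (\prod_j x j) * q ^+ n.+1)).
  transitivity (arsum n.+1 * (1 - q ^+ n.+1) * ((-1) ^+ r * (-1) ^+ r)); first
    by rewrite s2 mulr1.
  by rewrite exprS; field; rewrite X0 qn0 q0.
rewrite key !exprS; field; by rewrite qn0 q0.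
Qed.

Lemma ksum_eq0 (k : {ffun 'I_r -> 'I_m.+1}) :
  (ksum k == 0) = (k == [ffun=> ord0]).
Proof.
apply/idP/eqP => [|->]; last first.
  by rewrite /ksum big1 // => i _; rewrite ffunE.
rewrite sum_nat_eq0 => /forall_inP k0; apply/ffunP => i; apply: val_inj.
by rewrite ffunE /=; apply/eqP/k0.
Qed.

Lemma ksum_le (k : {ffun 'I_r -> 'I_m.+1}) : (ksum k <= r * m)%N.
Proof.
rewrite -[r in (r * m)%N](card_ord r) -sum_nat_const.
by apply: leq_sum => i _; rewrite -ltnS.
Qed.

Lemma arsumE n : (n <= r * m)%N ->
  arsum n = vdm x * (\prod_i \prod_j ipoch (x j / x i) m) *
   (((-1) ^+ r.+1 * \prod_j x j) ^+ n * q ^+ 'C(n, 2) *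
   (qpoch q q (r * m) / (qpoch q q n * qpoch q q (r * m - n)))).
Proof.
elim: n => [|n IH] nm.
  rewrite /arsum (eq_bigl (pred1 [ffun=> ord0])) => [|k]; last exact: ksum_eq0.
  rewrite big_pred1_eq bin0n !expr0 subn0 qpoch0 !mul1r divff ?qfact_neq0 // mulr1.
  rewrite /arterm; congr (_ * _).
    by apply: eq_bigr => i _; apply: eq_bigr => j _; rewrite /kval !ffunE /= !mulr1.
  apply: eq_bigr => i _; rewrite /arweight /kval ffunE /= ?bin0n !muln0 !expr0 !mul1r.
  by apply: eq_bigr => j _; rewrite subn0 /ipoch qpoch0 invr1 mulr1.
have qn1 : 1 - q ^+ n.+1 != 0 by rewrite subr_eq0 eq_sym qX.
apply: (mulIf qn1); rewrite arsumS // IH ?(ltnW nm) //.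
have -> : (r * m - n)%N = (r * m - n.+1).+1 by lia.
set e := (r * m - n.+1)%N; rewrite ![qpoch q q _.+1]qpochS -!exprS binS bin1.
have h1 := qfact_neq0 qX n; have h2 := qfact_neq0 qX e.
have h3 : 1 - q ^+ e.+1 != 0 by rewrite subr_eq0 eq_sym qX.
set X := _ * \prod_j x j; rewrite exprD [X ^+ n.+1]exprS.
by field; rewrite ?h1 ?h2 ?h3 ?qn1.
Qed.

(** On the level [|k| = n], the powers of [(-1)^(r+1) \prod_j x j] and of [q] in the summand cancel
    those of [arsumE]. What remains is the q-binomial weight of the q-Rothe sum of length [r m]. *)
Theorem ar_rothe_sum a b z :
  \sum_(k : {ffun 'I_r -> 'I_m.+1}) arterm (kval k) *
    ((z / ((-1) ^+ r.+1 * \prod_j x j)) ^+ ksum k * q ^- 'C(ksum k, 2) *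
     (rothe_base q a b (ksum k) * rothe_rest q a b (r * m) z (ksum k))) =
  vdm x * (\prod_i \prod_j ipoch (x j / x i) m) * qpoch q (z * q) (r * m).
Proof.
rewrite (partition_big (fun k => inord (ksum k) : 'I_(r * m).+1) predT) //=.
have := qrothe_sum q0 qX a b (r * m) z.
move=> /(congr1 (fun t => vdm x * (\prod_i \prod_j ipoch (x j / x i) m) * (t * qpoch
  q q (r * m)))).
rewrite /qrothe mulfVK ?qfact_neq0 // => <-.
rewrite mulr_suml mulr_sumr; apply: eq_bigr => n _.
have nE : (n <= r * m)%N by rewrite -ltnS.
rewrite (eq_bigl (fun k => ksum k == n)) => [|k]; last first.
  by rewrite -val_eqE /= inordK // ltnS ksum_le.
rewrite (eq_bigr (fun k => arterm (kval k) *
    ((z / ((-1) ^+ r.+1 * \prod_j x j)) ^+ n * q ^- 'C(n, 2) *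
     (rothe_base q a b n * rothe_rest q a b (r * m) z n)))) => [|k /eqP -> //].
rewrite -mulr_suml -/(arsum n) arsumE // expr_div_n.
have X0 : (-1) ^+ r.+1 * \prod_j x j != 0.
  by rewrite mulf_neq0 ?signr_eq0 //; apply/prodf_neq0.
move: X0; set X := _ * \prod_j x j => X0.
have X1 : X ^+ n != 0 by apply: expf_neq0.
have h0 : q ^+ 'C(n, 2) != 0 by apply: expf_neq0.
have h1 := qfact_neq0 qX n; have h2 := qfact_neq0 qX (r * m - n).
by field; rewrite X1 h0 h1 h2.
Qed.
End TerminatingAr.

(** * The terminating identity on a symmetric box of integers *)

Section SymmetricForm.

Lemma zbin2M2 (n : int) : zbin2 n * 2 = n * (n - 1).
Proof.
rewrite /zbin2 divzK //; suff : odd `|n| || odd `|n - 1|%N = true by lia.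
lia.
Qed.

Lemma zbin2_nat (n : nat) : zbin2 n%:Z = 'C(n, 2)%:Z.
Proof.
have : (zbin2 n%:Z * 2 = 'C(n, 2)%:Z * 2)%R; last by lia.
rewrite zbin2M2 -!PoszM mulnC -mul_bin_diag bin1.
by case: n => // n; rewrite mulnC; lia.
Qed.

Variables (F : fieldType) (q : F).
Hypothesis q0 : q != 0.

Lemma expfzB (m n : int) : q ^ (m - n) = q ^ m / q ^ n.
Proof. by rewrite expfzDr // -invr_expz. Qed.

Lemma rothe_base_qpoch a b k :
  rothe_base q a b k =
  (-1) ^+ k * q ^+ 'C(k.+1, 2) * qpoch q ((a + b * q ^+ k) / q ^+ k) k.
Proof.
rewrite /rothe_base /qpoch (reindex_inj rev_ord_inj) /=.
rewrite -triangular_sum big_nat_recl // add0n -prodrXr -[in (-1) ^+ k](card_ord k).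
rewrite -prodr_const big_mkord [X in _ * X * _](reindex_inj rev_ord_inj) /=.
rewrite -!big_split /=.
apply: eq_bigr => j _.
have -> : q ^+ k = q ^+ (k - j.+1).+1 * q ^+ j.
  by rewrite -exprD; congr (_ ^+ _); have := ltn_ord j; lia.
have h1 : q ^+ j != 0 by apply: expf_neq0.
have h2 : q ^+ (k - j.+1).+1 != 0 by apply: expf_neq0.
by field; rewrite h1 h2.
Qed.

(** Reversing the order of the factors and extracting [- z / q^j] from each produces the symbol of
    [1 / z]; this is the source of [(1/z)_\infty] in the final identity. *)
Lemma qpoch_shift_inv z n : z != 0 ->
  qpoch q (z / q ^+ n * q) n = (-1) ^+ n * z ^+ n * q ^- 'C(n, 2) * qpoch q z^-1 n.
Proof.
move=> z0; rewrite /qpoch -triangular_sum -prodrXr -[in (-1) ^+ n](card_ord n).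
rewrite -prodr_const -[in z ^+ n](card_ord n) -prodr_const big_mkord -prodfV.
rewrite (reindex_inj rev_ord_inj) /= -!big_split /=.
apply: eq_bigr => j _.
have -> : q ^+ n = q ^+ (n - j.+1) * q ^+ j * q.
  by rewrite -exprD -exprSr; congr (_ ^+ _); have := ltn_ord j; lia.
have h1 : q ^+ j != 0 by apply: expf_neq0.
have h2 : q ^+ (n - j.+1) != 0 by apply: expf_neq0.
by field; rewrite h1 h2 q0 z0.
Qed.

Hypothesis qX : forall n, q ^+ n.+1 != 1.
Variables (r : nat) (a b z : F) (x : 'I_r -> F).
Hypothesis z0 : z != 0.
Hypothesis x0 : forall i, x i != 0.
Implicit Type k : {ffun 'I_r -> int}.

Definition armono k :=
  (\prod_(i < r) \prod_(j < r | (i < j)%N)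
     ((x i * q ^ k i - x j * q ^ k j) / (x i - x j)))
  * (-1) ^ (r%:Z * zsum k)
  * q ^ (zsum k + r%:Z * \sum_(i < r) zbin2 (k i))
  * z ^ zsum k
  * \prod_(i < r) x i ^ (r%:Z * k i - zsum k).

(* Truncation of the two infinite products of the theorem at level [L], to be
   used for [|n| <= L] only: the absolute values just turn the nonnegative
   integers [L + n] and [L - n] into natural numbers. Its limit carries the
   additional factor [1 - a z]. *)
Definition tailpoch (L : nat) (n : int) :=
  qpoch q (a * q ^ (- n) + b) (absz (L%:Z + n)) *
  (qpoch q (z * q * (a + b * q ^ n)) (absz (L%:Z - n))
   - z * a * (1 - q ^+ (absz (L%:Z - n)))
     * qpoch q (z * q * (a + b * q ^ n)) (absz (L%:Z - n)).-1).

(** For fixed [k] this tends to the inverse square of the Macdonald product, whereas the other side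
    of the terminating identity carries only one inverse. One copy of the product therefore survives
    in the limit. *)
Definition arip (N : nat) k :=
  \prod_(i < r) \prod_(j < r)
    (ipoch q (x j / x i) (absz (N%:Z - k i)) * ipoch q (x i / x j) (absz (N%:Z + k i))).

Definition kshift (N : nat) (c : {ffun 'I_r -> 'I_(N.*2).+1}) : {ffun 'I_r -> int} :=
  [ffun i => (c i)%:Z - N%:Z].

Hypothesis xgen : forall i j n, i != j -> x i * q ^+ n != x j.

Lemma xgen_inj : injective x.
Proof.
move=> i j ij; apply/eqP/negPn/negP => /(xgen 0).
by rewrite expr0 mulr1 ij eqxx.
Qed.

Lemma armonoE k : armono k = vdm (fun i => x i * q ^ k i) / vdm x
  * (-1) ^ (r%:Z * zsum k)
  * q ^ (zsum k + r%:Z * \sum_(i < r) zbin2 (k i))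
  * z ^ zsum k
  * \prod_(i < r) x i ^ (r%:Z * k i - zsum k).
Proof.
rewrite /armono /vdm -prodf_div; do 4 congr (_ * _).
by apply: eq_bigr => i _; rewrite -prodf_div.
Qed.

Lemma kshift_sum N (c : {ffun 'I_r -> 'I_(N.*2).+1}) :
  zsum (kshift c) = (ksum c)%:Z - (r * N)%N%:Z.
Proof.
rewrite /zsum (eq_bigr (fun i => (c i)%:~R - N%:Z)) => [|i _].
  rewrite sumrB -sumMz intz sumr_const card_ord pmulrn mulrzz.
  by rewrite PoszM mulrC.
by rewrite ffunE intz.
Qed.

Lemma prod_weight_kshift N (c : {ffun 'I_r -> 'I_(N.*2).+1}) :
  \prod_i arweight q (N.*2) (fun i => x i / q ^+ N) (kval c) i =
  (\prod_i x i ^+ (r * c i)) * q ^ (r%:Z * \sum_i zbin2 (kshift c i))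
  * q ^ (- (r * r)%N%:Z * zbin2 N.+1%:Z) * arip N (kshift c).
Proof.
rewrite /arweight /arip /kval big_split /=; congr (_ * _); last first.
  apply: eq_bigr => i _; apply: eq_bigr => j _; rewrite ffunE.
  have qN0 : q ^+ N != 0 by apply: expf_neq0.
  have e i1 j1 : x i1 / q ^+ N / (x j1 / q ^+ N) = x i1 / x j1.
    by have := x0 j1 => xj0; field; rewrite qN0 xj0.
  rewrite !e; congr (ipoch _ _ _ * ipoch _ _ _); last by lia.
  by have := ltn_ord (c i); lia.
rewrite mulr_sumr -mulrA.
have -> : q ^ (\sum_i r%:Z * zbin2 (kshift c i)) * q ^ (- (r * r)%N%:Z * zbin2 N.+1%:Z)
   = \prod_i q ^ (r%:Z * (zbin2 (kshift c i) - zbin2 N.+1%:Z)).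
  rewrite -expfzDr //.
  have -> : - (r * r)%N%:Z * zbin2 N.+1%:Z = \sum_(i < r) (- r%:Z * zbin2 N.+1%:Z).
    by rewrite sumr_const card_ord pmulrn mulrzz; lia.
  rewrite -big_split /= (big_morph (fun e : int => q ^ e) (id1 := 1) (op1 := *%R)) //.
    by apply: eq_bigr => i _; congr (_ ^ _); ring.
  by move=> m n; rewrite expfzDr.
rewrite -big_split /=; apply: eq_bigr => i _.
rewrite expr_div_n -!exprM -mulrA; congr (_ * _).
rewrite !exprnP invr_expz -expfzDr //; congr (_ ^ _).
rewrite ffunE; have h1 := zbin2M2 N.+1; have h2 := zbin2M2 ((c i)%:Z - N%:Z).
have h3 := zbin2M2 (c i)%:Z; have h4 := zbin2_nat (c i).
rewrite !PoszM -h4.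
(* The cross term [N (c i)] is what the powers of [x i / q^N] compensate. *)
suff -> : zbin2 (c i)%:Z = zbin2 ((c i)%:Z - N%:Z) - zbin2 N.+1%:Z + N%:Z * (c i)%:Z.
  by ring.
suff : 2 * zbin2 (c i)%:Z = 2 * (zbin2 ((c i)%:Z - N%:Z) - zbin2 N.+1%:Z + N%:Z * (c
  i)%:Z).
  by lia.
nia.
Qed.

(** The replacement of [a] by [a q^L] is made for this: [(a q^L + b q^k) / q^k] becomes
    [a q^(-n) + b], free of [L]. Replacing [z] by [z / q^L] has the same effect on the argument of
    [rothe_rest]. *)
Lemma rothe_base_kshift (L k : nat) (n : int) : k%:Z = n + L%:Z ->
  rothe_base q (a * q ^+ L) b k =
  (-1) ^+ k * q ^+ 'C(k.+1, 2) * qpoch q (a * q ^ (- n) + b) (absz (L%:Z + n)).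
Proof.
move=> kE; rewrite rothe_base_qpoch; congr (_ * qpoch _ _ _); last by lia.
rewrite mulrDl mulfK ?expf_neq0 //; congr (_ + _).
by rewrite -mulrA !exprnP invr_expz -expfzDr // kE; congr (_ * _ ^ _); ring.
Qed.

Lemma rothe_rest_kshift (L k : nat) (n : int) : k%:Z = n + L%:Z -> (k <= L.*2)%N ->
  rothe_rest q (a * q ^+ L) b L.*2 (z / q ^+ L) k =
  qpoch q (z * q * (a + b * q ^ n)) (absz (L%:Z - n))
   - z * a * (1 - q ^+ (absz (L%:Z - n)))
     * qpoch q (z * q * (a + b * q ^ n)) (absz (L%:Z - n)).-1.
Proof.
move=> kE kL; rewrite /rothe_rest.
have -> : absz (L%:Z - n) = (L.*2 - k)%N by lia.
have qL0 : q ^+ L != 0 by apply: expf_neq0.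
have -> : q ^+ k = q ^ n * q ^+ L by rewrite !exprnP kE expfzDr.
have -> : z / q ^+ L * q * (a * q ^+ L + b * (q ^ n * q ^+ L)) =
    z * q * (a + b * q ^ n) by field.
by have -> : z / q ^+ L * (a * q ^+ L) = z * a by field.
Qed.

(** Together with [vdm x], the part of the shifted summand that does not depend on the index; it
    cancels against the prefactors of the right-hand side in [ar_terminating]. *)
Definition kshift_cst (N : nat) :=
  (-1) ^+ (r * (r * N)) * z ^+ (r * N) * q ^ ((r * N)%N%:Z - (r * r)%N%:Z * zbin2
    N.+1%:Z).

Lemma arterm_kshift N (c : {ffun 'I_r -> 'I_(N.*2).+1}) :
  arterm q (N.*2) (fun i => x i / q ^+ N) (kval c) *
    ((z / q ^+ (r * N) / ((-1) ^+ r.+1 * \prod_j (x j / q ^+ N))) ^+ ksum c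
     * q ^- 'C(ksum c, 2) *
     (rothe_base q (a * q ^+ (r * N)) b (ksum c) *
      rothe_rest q (a * q ^+ (r * N)) b (r * N.*2) (z / q ^+ (r * N)) (ksum c)))
  = kshift_cst N * vdm x * (armono (kshift c) * tailpoch (r * N) (zsum (kshift c))
     * arip N (kshift c)).
Proof.
have kE := kshift_sum c; set n := zsum _ in kE *; set L := (r * N)%N in kE *.
have KE : (ksum c)%:Z = n + L%:Z by rewrite kE subrK.
have -> : (r * N.*2)%N = L.*2 by rewrite doubleMr.
have kL : (ksum c <= L.*2)%N by rewrite /L doubleMr ksum_le.
rewrite (rothe_base_kshift KE) (rothe_rest_kshift KE) //.
rewrite /arterm prod_weight_kshift armonoE -/n /tailpoch.
have -> : vdm (fun i => x i / q ^+ N * q ^+ kval c i) = vdm (fun i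
  => x i * q ^ kshift c i).
  apply: eq_bigr => i _; apply: eq_bigr => j _.
  by rewrite !ffunE /kval !expfzB -!exprnP ![_ / _ * _]mulrAC !mulrA.
rewrite big_split /= prodr_const card_ord exprVn -exprM [(N * r)%N]mulnC -/L.
rewrite -mulrA; set Q := qpoch _ _ _; set R := qpoch _ _ _ - _.
set V := vdm _; set A := arip _ _; set K := ksum c in KE kL *.
have vx0 : vdm x != 0 by apply/vdm_neq0/xgen_inj.
have X0 : \prod_i x i != 0 by apply/prodf_neq0.
have XE : \prod_i x i ^ (r%:Z * kshift c i - n) =
    (\prod_i x i ^+ (r * c i)) / (\prod_i x i) ^+ K.
  rewrite -prodrXl -prodf_div; apply: eq_bigr => i _.
  rewrite !exprnP invr_expz -expfzDr //; congr (_ ^ _).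
  by rewrite ffunE KE /L !PoszM; ring.
rewrite XE /kshift_cst -/L.
have zE : z ^+ K = z ^ n * z ^+ L by rewrite !exprnP KE expfzDr.
have sE : (-1) ^+ (r * K) = (-1) ^+ (r * L) * (-1) ^ (r%:Z * n) :> F.
  by rewrite !exprnP !PoszM KE mulrDr expfzDr ?oppr_eq0 ?oner_eq0 // mulrC.
have qE : q ^ (n + r%:Z * \sum_i zbin2 (kshift c i)) *
    q ^ (L%:Z - (r * r)%N%:Z * zbin2 N.+1%:Z) =
    q ^+ K * q ^ (r%:Z * \sum_i zbin2 (kshift c i))
    * q ^ (- (r * r)%N%:Z * zbin2 N.+1%:Z).
  by rewrite exprnP KE -!expfzDr //; congr (_ ^ _); ring.
have qL0 : q ^+ L != 0 by apply: expf_neq0.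
have -> : z / q ^+ L / ((-1) ^+ r.+1 * ((\prod_i x i) / q ^+ L)) =
    (-1) ^+ r.+1 * z / \prod_i x i.
  have s0 : (-1) ^+ r.+1 != 0 :> F by rewrite signr_eq0.
  have s2 : (-1) ^+ r.+1 * (-1) ^+ r.+1 = 1 :> F.
    by rewrite -exprD addnn -mul2n exprM sqrrN expr1n expr1n.
  apply: (mulfI s0); rewrite [RHS]mulrA [(-1) ^+ r.+1 * (_ * z)]mulrA s2.
  by field; rewrite s0 X0 qL0.
rewrite expr_div_n exprMn -exprM zE binS bin1 exprD.
have -> : (-1) ^+ (r.+1 * K) = (-1) ^+ K * ((-1) ^+ (r * L) * (-1) ^ (r%:Z * n)) :> F.
  by rewrite -sE -exprD mulSn.
have s3 : (-1) ^+ K * (-1) ^+ K = 1 :> F.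
  by rewrite -exprD addnn -mul2n exprM sqrrN expr1n expr1n.
set B := \prod_i x i ^+ _; set XX := \prod_i x i; set s := (-1) ^ _.
set qs := q ^ (r%:Z * _) in qE *; set q1 := q ^ (- _ * _) in qE *.
set q2 := q ^ (_ - _) in qE *; set q3 := q ^ (_ + _) in qE *.
set zn := z ^ n.
have qC0 : q ^+ 'C(K, 2) != 0 by apply: expf_neq0.
have XK0 : XX ^+ K != 0 by apply: expf_neq0.
transitivity (V * B / XX ^+ K * A * Q * R * (-1) ^+ (r * L) * s * zn * z ^+ L *
  ((-1) ^+ K * (-1) ^+ K)
   * (q ^+ K * qs * q1)).
  by field; rewrite qC0 XK0.
by rewrite s3 -qE; field; rewrite vx0 XK0.
Qed.

Theorem ar_terminating N :
  \sum_(c : {ffun 'I_r -> 'I_(N.*2).+1})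
     armono (kshift c) * tailpoch (r * N) (zsum (kshift c)) * arip N (kshift c)
  = (\prod_i \prod_j ipoch q (x j / x i) N.*2)
    * (qpoch q (z * q) (r * N) * qpoch q z^-1 (r * N)).
Proof.
have qN0 : q ^+ N != 0 by apply: expf_neq0.
have xt0 i : x i / q ^+ N != 0 by rewrite mulf_neq0 ?invr_eq0.
have xtgen i j n : i != j -> x i / q ^+ N * q ^+ n != x j / q ^+ N.
  by move=> ij; rewrite mulrAC (inj_eq (mulIf (invr_neq0 qN0))) xgen.
have := ar_rothe_sum q0 qX N.*2 xt0 xtgen (a * q ^+ (r * N)) b (z / q ^+ (r * N)).
rewrite (eq_bigr _ (fun c _ => arterm_kshift c)) -mulr_sumr.
have vx0 : vdm x != 0 by apply/vdm_neq0/xgen_inj.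
have -> : vdm (fun i => x i / q ^+ N) = q ^- N ^+ 'C(r, 2) * vdm x.
  by rewrite -vdm_scale; apply: eq_bigr => i _; apply: eq_bigr => j _;
    rewrite ![q ^- N * _]mulrC.
have -> : \prod_i \prod_j ipoch q (x j / q ^+ N / (x i / q ^+ N)) N.*2 =
    \prod_i \prod_j ipoch q (x j / x i) N.*2.
  apply: eq_bigr => i _; apply: eq_bigr => j _; congr (ipoch _ _ _).
  by have xi0 := x0 i; field; rewrite qN0 xi0.
(* The symbol of [z q^(1-L)] of length [2 L] is cut in half: the first half gives that of [1 / z],
   the second that of [z q]. *)
rewrite -doubleMr -[(r * N).*2]addnn qpochD qpoch_shift_inv //.
set L := (r * N)%N.
have qL0 : q ^+ L != 0 by apply: expf_neq0.
have -> : z / q ^+ L * q * q ^+ L = z * q by field.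
set S := \sum_c _; set P := \prod_i _.
have C0 : kshift_cst N != 0 by rewrite /kshift_cst !mulf_neq0 ?signr_eq0 ?expf_neq0
  ?expfz_neq0.
have CE : kshift_cst N = q ^- N ^+ 'C(r, 2) * ((-1) ^+ L * z ^+ L * q ^- 'C(L, 2)).
  rewrite /kshift_cst -/L -[(-1) ^+ (r * L)]signr_odd -[(-1) ^+ L]signr_odd.
  have -> : odd (r * L) = odd L by rewrite /L !oddM andbA andbb.
  have -> : q ^ (L%:Z - (r * r)%N%:Z * zbin2 N.+1%:Z)
    = q ^- N ^+ 'C(r, 2) * q ^- 'C(L, 2).
    rewrite exprVn -exprM !exprnP !invr_expz -expfzDr //; congr (_ ^ _).
    rewrite !PoszM -!zbin2_nat.
    have h1 := zbin2M2 N.+1; have h2 := zbin2M2 r; have h3 := zbin2M2 L.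
    have LE : L%:Z = r%:Z * N%:Z by rewrite /L PoszM.
    have NE : N.+1%:Z = N%:Z + 1 by rewrite -addn1 PoszD.
    rewrite LE NE in h1 h3 *.
    suff : 2 * (r%:Z * N%:Z - r%:Z * r%:Z * zbin2 (N%:Z + 1)) =
      2 * (- (N%:Z * zbin2 r%:Z) - zbin2 (r%:Z * N%:Z)) by lia.
    rewrite !mulrBr mulrN [2 * zbin2 _]mulrC h3.
    have -> : 2 * (r%:Z * r%:Z * zbin2 (N%:Z + 1))
      = r%:Z * r%:Z * (zbin2 (N%:Z + 1) * 2) by ring.
    have -> : 2 * (N%:Z * zbin2 r%:Z) = N%:Z * (zbin2 r%:Z * 2) by ring.
    by rewrite h1 h2; ring.
  by ring.
move=> e; apply: (mulfI (mulf_neq0 C0 vx0)); rewrite e CE.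
by ring.
Qed.
End SymmetricForm.

(** * Limits of sequences *)

Section SequenceLimits.
Variable K : numFieldType.
Implicit Types (u v : nat -> K) (l : K).

Definition ncvg u l : Prop := u @ \oo --> l.

Lemma ncvgP u l : ncvg u l <->
  forall e, 0 < e -> exists N : nat, forall n, (N <= n)%N -> `|l - u n| <= e.
Proof.
split=> [/cvgrPdist_le h e /h [N _ hN]|h]; first by exists N.
by apply/cvgrPdist_le => e /h [N hN]; exists N.
Qed.

Lemma ncvg_cst l : ncvg (fun=> l) l. Proof. exact: cvg_cst. Qed.

Lemma ncvg_ext u v l : u =1 v -> ncvg u l -> ncvg v l.
Proof. by move=> /funext ->. Qed.

Lemma ncvgM u v l l' : ncvg u l -> ncvg v l' -> ncvg (fun n => u n * v n) (l * l').
Proof. exact: cvgM. Qed.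

Lemma ncvgD u v l l' : ncvg u l -> ncvg v l' -> ncvg (fun n => u n + v n) (l + l').
Proof. exact: cvgD. Qed.

Lemma ncvgB u v l l' : ncvg u l -> ncvg v l' -> ncvg (fun n => u n - v n) (l - l').
Proof. exact: cvgB. Qed.

Lemma ncvgV u l : l != 0 -> ncvg u l -> ncvg (fun n => (u n)^-1) l^-1.
Proof. by move=> l0; exact: cvgV. Qed.

Lemma ncvg_prod m (u : 'I_m -> nat -> K) (l : 'I_m -> K) :
  (forall i, ncvg (u i) (l i)) -> ncvg (fun n => \prod_(i < m) u i n) (\prod_(i < m) l i).
Proof.
elim: m u l => [|m IH] u l ul.
  rewrite big_ord0; apply: (@ncvg_ext (fun=> 1)); last exact: ncvg_cst.
  by move=> n; rewrite big_ord0.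
rewrite big_ord_recl; apply: (@ncvg_ext (fun n
  => u ord0 n * \prod_(i < m) u (lift ord0 i) n)).
  by move=> n; rewrite big_ord_recl.
by apply: ncvgM => //; apply: IH => i; apply: ul.
Qed.

Lemma ncvg_subseq u l (f : nat -> nat) :
  (forall N : nat, exists M : nat, forall n, (M <= n)%N -> (N <= f n)%N) ->
  ncvg u l -> ncvg (fun n => u (f n)) l.
Proof.
move=> hf /ncvgP ul; apply/ncvgP => e /ul [N hN]; have [M hM] := hf N.
by exists M => n /hM /hN.
Qed.

Lemma ncvg_eventually u v l (N : nat) :
  (forall n, (N <= n)%N -> u n = v n) -> ncvg u l -> ncvg v l.
Proof.
move=> uv /ncvgP ul; apply/ncvgP => e /ul [M hM]; exists (maxn N M) => n.
by rewrite geq_max => /andP[/uv <- /hM].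
Qed.

Lemma qpoch_infE q x l : ncvg (qpoch q x) l -> qpoch_inf q x = l.
Proof.
move=> h; apply: cvg_lim; first exact: norm_hausdorff.
by apply: (ncvg_ext _ h) => n; rewrite /qpoch big_mkord.
Qed.

Lemma has_sumP (I : choiceType) (f : I -> K) s :
  (forall e, 0 < e -> exists A : {fset I}, forall B : {fset I}, (A `<=` B)%fset ->
     `|s - \sum_(i <- B) f i| <= e) -> has_sum f s.
Proof.
have F : Filter (@totally I) by have [] := @totally_filter I.
move=> h; apply/(@cvgrPdist_le _ _ _ _ F) => e /h [A hA]; exists A => // B AB.
by rewrite /partial_sum -(big_seq_fsetE _ B xpredT f) hA.
Qed.
End SequenceLimits.

(** * The real-valued modulus of a complex number *)

Section Modulus.
Variable R : realType.
Implicit Types w t : R[i].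

(** The norm of [R[i]] takes its values in [R[i]]; with real values, estimates can use suprema, the
    exponential and linear arithmetic over [R]. *)
Definition cabs w : R := complex.Re `|w|.

Lemma cabsE w : `|w| = (cabs w)%:C%C.
Proof. by rewrite /cabs RRe_real // normr_real. Qed.

Lemma cabs_le w (e : R) : (`|w| <= e%:C%C) = (cabs w <= e).
Proof. by rewrite cabsE lecR. Qed.

Lemma cabs_ge0 w : 0 <= cabs w.
Proof. by rewrite -lecR -cabsE normr_ge0. Qed.

Lemma cabsM w t : cabs (w * t) = cabs w * cabs t.
Proof. by apply: (@complexI R); rewrite rmorphM /= -!cabsE normrM. Qed.

Lemma cabsV w : cabs w^-1 = (cabs w)^-1.
Proof. by apply: (@complexI R); rewrite fmorphV /= -!cabsE normfV. Qed.

Lemma cabsN w : cabs (- w) = cabs w.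
Proof. by rewrite /cabs normrN. Qed.

Lemma cabs0 : cabs 0 = 0. Proof. by rewrite /cabs normr0. Qed.

Lemma cabs1 : cabs 1 = 1. Proof. by rewrite /cabs normr1. Qed.

Lemma cabsD w t : cabs (w + t) <= cabs w + cabs t.
Proof. by rewrite -lecR rmorphD /= -!cabsE ler_normD. Qed.

Lemma cabsB w t : cabs (w - t) <= cabs w + cabs t.
Proof. by rewrite -(cabsN t) cabsD. Qed.

Lemma cabsX w n : cabs (w ^+ n) = cabs w ^+ n.
Proof. by elim: n => [|n IH]; rewrite ?cabs1 // !exprS cabsM IH. Qed.

Lemma cabsXz w (n : int) : cabs (w ^ n) = cabs w ^ n.
Proof. by case: n => n; rewrite ?NegzE -?exprnP -?exprnN ?cabsV cabsX. Qed.

Lemma cabs_sum (I : Type) (s : seq I) P (F : I -> R[i]) :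
  cabs (\sum_(i <- s | P i) F i) <= \sum_(i <- s | P i) cabs (F i).
Proof.
elim/big_rec2: _ => [|i y x _ h]; first by rewrite cabs0.
by rewrite (le_trans (cabsD _ _)) // lerD2l.
Qed.

Lemma cabs_prod (I : Type) (s : seq I) P (F : I -> R[i]) :
  cabs (\prod_(i <- s | P i) F i) = \prod_(i <- s | P i) cabs (F i).
Proof. by apply: (big_morph cabs cabsM cabs1). Qed.

Lemma cabs_eq0 w : (cabs w == 0) = (w == 0).
Proof. by rewrite -(inj_eq (@complexI R)) -cabsE normr_eq0. Qed.

Lemma cabs_gt0 w : (0 < cabs w) = (w != 0).
Proof. by rewrite lt_neqAle cabs_ge0 andbT eq_sym cabs_eq0. Qed.

Lemma cabs_Re w : `|complex.Re w| <= cabs w.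
Proof. by rewrite -lecR -cabsE normc_ge_Re. Qed.

Lemma cabs_Im w : `|complex.Im w| <= cabs w.
Proof.
rewrite -lecR -cabsE normc_def lecR -sqrtr_sqr ler_wsqrtr //.
by rewrite lerDr sqr_ge0.
Qed.

Lemma ncvg_cabs (u : nat -> R[i]) l : ncvg u l <->
  forall e : R, 0 < e -> exists N : nat, forall n, (N <= n)%N -> cabs (l - u n) <= e.
Proof.
rewrite ncvgP; split=> h e e0.
  have [|N hN] := h e%:C%C; first by rewrite ltcR.
  by exists N => n /hN; rewrite cabs_le.
have eE : e = (complex.Re e)%:C%C by rewrite RRe_real // gtr0_real.
have [|N hN] := h (complex.Re e); first by rewrite -ltcR -eE.
by exists N => n /hN; rewrite eE cabs_le.
Qed.

Lemma ncvg_complex (u : nat -> R[i]) (a b : R) :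
  ncvg (fun n => complex.Re (u n)) a -> ncvg (fun n => complex.Im (u n)) b ->
  ncvg u (Complex a b).
Proof.
move=> /ncvgP ha /ncvgP hb; apply/ncvg_cabs => e e0.
have [|N hN] := ha (e / 2); first by lra.
have [|M hM] := hb (e / 2); first by lra.
exists (maxn N M) => n; rewrite geq_max => /andP[/hN h1 /hM h2].
have -> : Complex a b - u n = (a - complex.Re (u n))%:C%C +
    'i%C * (b - complex.Im (u n))%:C%C.
  case: (u n) => c d; apply/eqP; rewrite eq_complex /=.
  by apply/andP; split; apply/eqP => /=; ring.
apply: (le_trans (cabsD _ _)); rewrite cabsM.
have real_abs (t : R) : cabs t%:C%C = `|t|.
  by apply: (@complexI R); rewrite -cabsE normc_def /= expr0n addr0 sqrtr_sqr.
have -> : cabs ('i%C : R[i]) = 1.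
  by apply: (@complexI R); rewrite -cabsE normc_def /= expr0n expr1n add0r sqrtr1.
by rewrite !real_abs; lra.
Qed.
End Modulus.

(** * Bounds and convergence of q-Pochhammer symbols *)

Section ProductBounds.
Variable R : realType.

(** By [1 + t <= exp t] the product is controlled by a geometric series. *)
Lemma prod1D_bounded (c p : R) : 0 <= c -> 0 <= p < 1 ->
  exists C : R, 0 < C /\ forall n, \prod_(j < n) (1 + c * p ^+ j) <= C.
Proof.
move=> c0 /andP[p0 p1]; exists (expR (c / (1 - p))); split=> [|n]; first exact: expR_gt0.
have h : \prod_(j < n) (1 + c * p ^+ j) <= expR (\sum_(j < n) c * p ^+ j).
  elim: n => [|n IH]; first by rewrite !big_ord0 expR0.
  rewrite !big_ord_recr /= expRD ler_pM ?expR_ge1Dx //.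
    by apply: prodr_ge0 => j _; rewrite addr_ge0 ?mulr_ge0 ?exprn_ge0.
  by rewrite addr_ge0 ?mulr_ge0 ?exprn_ge0.
apply: (le_trans h); rewrite ler_expR -mulr_sumr ler_wpM2l //.
have -> : \sum_(j < n) p ^+ j = (1 - p ^+ n) / (1 - p).
  by apply: (canRL (mulfK _)); [lra|have := subrX1 p n; lra].
rewrite ler_pdivrMr; last by lra.
by rewrite mulVf; [have := exprn_ge0 n p0; lra|lra].
Qed.

Variable q : R[i].
Hypothesis q1 : cabs q < 1.

Lemma cabs_q01 : 0 <= cabs q < 1. Proof. by rewrite cabs_ge0. Qed.

Lemma qpoch_bounded (c : R) : 0 <= c -> exists C : R, 0 < C /\
  forall x n, cabs x <= c -> cabs (qpoch q x n) <= C.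
Proof.
move=> c0; have [C [C0 hC]] := prod1D_bounded c0 cabs_q01.
exists C; split=> // x n xc; apply: le_trans (hC n); rewrite cabs_prod.
apply: ler_prod => j _; rewrite cabs_ge0 (le_trans (cabsB _ _)) // cabs1 lerD2l.
by rewrite cabsM cabsX ler_wpM2r // exprn_ge0 // cabs_ge0.
Qed.

Lemma real_geo_cvg (v : nat -> R) (C p : R) : 0 <= C -> 0 <= p < 1 ->
  (forall n, `|v n.+1 - v n| <= C * p ^+ n) -> exists l, ncvg v l.
Proof.
move=> C0 /andP[p0 p1] hv.
have cv : cvgn (series (telescope v)).
  apply: normed_cvg; apply: (@series_le_cvg _ _ (geometric C p)) => [n|n|n|] /=.
  - exact: normr_ge0.
  - by rewrite mulr_ge0 ?exprn_ge0.
  - exact: hv.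
  - by apply: is_cvg_geometric_series; rewrite ger0_norm.
exists (limn (series (telescope v)) + v 0%N).
apply: (@ncvg_ext _ (fun n => series (telescope v) n + v 0%N)).
  by move=> n; rewrite telescopeK subrK.
by apply: ncvgD => //; exact: ncvg_cst.
Qed.

Lemma qpoch_cvg x : ncvg (qpoch q x) (qpoch_inf q x).
Proof.
have [C [C0 hC]] := qpoch_bounded (cabs_ge0 x).
have step n : cabs (qpoch q x n.+1 - qpoch q x n) <= C * cabs x * cabs q ^+ n.
  have -> : qpoch q x n.+1 - qpoch q x n = - (qpoch q x n * x * q ^+ n).
    by rewrite qpochS; ring.
  by rewrite cabsN !cabsM cabsX ler_wpM2r ?exprn_ge0 ?cabs_ge0 // ler_wpM2r
    ?cabs_ge0 // hC.
have D0 : 0 <= C * cabs x by rewrite mulr_ge0 ?cabs_ge0 // ltW.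
have [a ha] : exists l, ncvg (fun n => complex.Re (qpoch q x n)) l.
  apply: (real_geo_cvg D0 cabs_q01) => n; rewrite -raddfB.
  exact: le_trans (cabs_Re _) (step n).
have [b hb] : exists l, ncvg (fun n => complex.Im (qpoch q x n)) l.
  apply: (real_geo_cvg D0 cabs_q01) => n; rewrite -raddfB.
  exact: le_trans (cabs_Im _) (step n).
have h := ncvg_complex ha hb.
by rewrite (qpoch_infE h).
Qed.

Lemma cabs_expq_small (c e : R) : 0 < e -> exists N : nat, forall n, (N <= n)%N ->
  c * cabs q ^+ n <= e.
Proof.
move=> e0; have /andP[p0 p1] := cabs_q01.
have : ncvg (fun n => c * cabs q ^+ n) 0.
  by apply: cvg_geometric; rewrite ger0_norm.
move=> /ncvgP /(_ e e0) [N hN]; exists N => n /hN; rewrite sub0r normrN.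
exact: le_trans (ler_norm _).
Qed.

(** The factors stay at a distance [d > 0] from zero: almost all have modulus at least [1/2], and
    finitely many nonzero ones remain. Then [1 / (1 - t) = 1 + t / (1 - t)] bounds the inverse by a
    product of terms [1 + (|w| / d) |q|^j]. *)
Lemma ipoch_bounded (w : R[i]) : (forall n, 1 - w * q ^+ n.+1 != 0) ->
  exists C : R, 0 < C /\ forall n, cabs (ipoch q w n) <= C.
Proof.
move=> w1.
have [d [d0 hd]] : exists d : R, 0 < d /\ forall n, d <= cabs (1 - w * q ^+ n.+1).
  have [|N hN] := @cabs_expq_small (cabs w) (1 / 2); first by lra.
  have [d [d0 hd]] : exists d : R, 0 < d /\ forall n, (n < N)%N -> d <= cabs (1 - w
    * q ^+ n.+1).
    elim: {hN} (N) => [|M [d [d0 hd]]]; first by exists 1; split=> //; lra.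
    exists (Num.min d (cabs (1 - w * q ^+ M.+1))); split=> [|n].
      by rewrite lt_min d0 cabs_gt0 w1.
    rewrite ltnS leq_eqVlt => /orP[/eqP ->|/hd h]; first by rewrite ge_min lexx orbT.
    by rewrite ge_min h.
  exists (Num.min d (1 / 2)); split=> [|n]; first by rewrite lt_min d0; lra.
  have [/hd h|Nn] := ltnP n N; first by rewrite ge_min h.
  rewrite ge_min; apply/orP; right.
  have := hN n.+1 (leqW Nn); rewrite -cabsX -cabsM => h.
  have := cabsD (1 - w * q ^+ n.+1) (w * q ^+ n.+1).
  by rewrite subrK cabs1; lra.
have c0 : 0 <= cabs w / d by rewrite divr_ge0 ?cabs_ge0 // ltW.
have [C [C0 hC]] := prod1D_bounded c0 cabs_q01.
exists C; split=> // n; apply: le_trans (hC n).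
rewrite /ipoch /qpoch -prodfV cabs_prod; apply: ler_prod => j _.
rewrite cabs_ge0 /= -mulrA -exprS.
have -> : (1 - w * q ^+ j.+1)^-1 = 1 + w * q ^+ j.+1 / (1 - w * q ^+ j.+1).
  by have := w1 j => h; field.
apply: (le_trans (cabsD _ _)); rewrite cabs1 lerD2l !cabsM cabsV cabsX mulrAC.
apply: ler_pM; rewrite ?exprn_ge0 ?cabs_ge0 ?mulr_ge0 ?invr_ge0 ?cabs_ge0 //.
  by rewrite ler_wpM2l ?cabs_ge0 // lef_pV2 ?posrE // cabs_gt0.
by rewrite exprS ler_piMl ?exprn_ge0 ?cabs_ge0 // ltW.
Qed.

Lemma ncvg_neq0 (u : nat -> R[i]) l (C : R) : 0 < C -> (forall n, u n != 0) ->
  (forall n, cabs (u n)^-1 <= C) -> ncvg u l -> l != 0.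
Proof.
move=> C0 u0 uC /ncvg_cabs h; apply/eqP => l0.
have [|N hN] := h (C^-1 / 2); first by rewrite divr_gt0 ?invr_gt0.
have := hN N (leqnn N); rewrite l0 sub0r cabsN => h1.
have := uC N; rewrite cabsV => h2.
have : C^-1 <= cabs (u N) by rewrite -[X in _ <= X]invrK lef_pV2 ?posrE // invr_gt0
  cabs_gt0.
have : 0 < C^-1 by rewrite invr_gt0.
by lra.
Qed.

Lemma qpoch_inf_neq0 (w : R[i]) : (forall n, 1 - w * q ^+ n.+1 != 0) ->
  qpoch_inf q (w * q) != 0.
Proof.
move=> w1; have [C [C0 hC]] := ipoch_bounded w1.
apply: (ncvg_neq0 C0 _ hC (@qpoch_cvg _)) => n.
by apply/prodf_neq0 => j _; rewrite -mulrA -exprS.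
Qed.
End ProductBounds.

Arguments qpoch_cvg [R q] q1 x.

(** * Dominated summation over an arbitrary index set *)

Section Summability.
Variables (R : realType) (I : choiceType).
Implicit Types (G : I -> R) (F : I -> R[i]).

Definition sumbounded G := exists M : R, forall s : seq I, uniq s -> \sum_(i <- s) G
  i <= M.

Lemma sumboundedZ (c : R) G : 0 <= c -> sumbounded G -> sumbounded (fun i => c * G i).
Proof.
move=> c0 [M hM]; exists (c * M) => s us.
by rewrite -mulr_sumr ler_wpM2l // hM.
Qed.

(** Take a finite sum within [e] of the supremum of all finite sums: a disjoint finite set can add
    at most [e] to it. *)
Lemma sumbounded_tail G (e : R) : sumbounded G -> 0 < e ->
  exists A : {fset I}, forall s : seq I, uniq s -> {in s, forall i, i \notin A} ->
    \sum_(i <- s) G i <= e.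
Proof.
move=> [M hM] e0.
pose E := [set t | exists2 s : seq I, uniq s & t = \sum_(i <- s) G i].
have hE : has_sup E.
  split; first by exists (\sum_(i <- [::]) G i), [::].
  by exists M => t [s us ->]; apply: hM.
have [t [s us ->] ht] := sup_adherent e0 hE.
exists [fset i in s]%fset => s' us' ss'.
have : E (\sum_(i <- s ++ s') G i).
  exists (s ++ s') => //; rewrite cat_uniq us us' andbT.
  by apply/hasPn => i /ss'; rewrite inE.
by move=> /(sup_upper_bound hE); rewrite big_cat /=; lra.
Qed.

Lemma ncvg_sum (K : numFieldType) (s : seq I) (u : I -> nat -> K) (l : I -> K) :
  (forall i, ncvg (u i) (l i)) -> ncvg (fun n => \sum_(i <- s) u i n) (\sum_(i <- s) l i).
Proof.
move=> ul; elim: s => [|i s IH].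
  rewrite big_nil; apply: (@ncvg_ext _ (fun=> 0)); last exact: ncvg_cst.
  by move=> n; rewrite big_nil.
rewrite big_cons; apply: (@ncvg_ext _ (fun n => u i n + \sum_(j <- s) u j n)).
  by move=> n; rewrite big_cons.
exact: ncvgD.
Qed.

Lemma sumC_seq F (s t : seq I) : uniq s -> uniq t -> (forall i, i \notin s -> F i = 0) ->
  \sum_(i <- s) F i = \sum_(i <- t) F i + \sum_(i <- s | i \notin t) F i.
Proof.
move=> us ut F0; rewrite (bigID (mem t)) /=; congr (_ + _).
rewrite [RHS](bigID (mem s)) /= [X in _ = _ + X]big1 // addr0.
rewrite -[LHS]big_filter -[RHS]big_filter.
apply/perm_big/uniq_perm; rewrite ?filter_uniq // => i.
by rewrite !mem_filter andbC.
Qed.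

(** For each finite [B] one large [N], depending on [B], suffices. The error splits into [S - SN N],
    the change from [F] to [FN N] on [B], and the part of [FN N] outside [B]. Only the last needs
    the majorant. *)
Lemma tannery G F (FN : nat -> I -> R[i]) (SN : nat -> R[i]) S :
  sumbounded G -> (forall N i, cabs (FN N i) <= G i) ->
  (forall i, ncvg (FN^~ i) (F i)) ->
  (forall N, exists s : seq I, [/\ uniq s, forall i, i \notin s -> FN N i = 0 &
     \sum_(i <- s) FN N i = SN N]) ->
  ncvg SN S -> has_sum F S.
Proof.
move=> bG FG FF hs /ncvg_cabs hS; apply: has_sumP => e e0.
have eE : e = (complex.Re e)%:C%C by rewrite RRe_real // gtr0_real.
have {}e0 : 0 < complex.Re e by rewrite -ltcR -eE.
have [|A hA] := sumbounded_tail bG (e := complex.Re e / 3); first by lra.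
exists A => B AB; rewrite eE cabs_le.
have /ncvg_cabs hB := @ncvg_sum _ (enum_fset B) _ _ FF.
have [|N1 hN1] := hS (complex.Re e / 3); first by lra.
have [|N2 hN2] := hB (complex.Re e / 3); first by lra.
pose N := maxn N1 N2; have {}hN1 := hN1 N (leq_maxl _ _).
have {}hN2 := hN2 N (leq_maxr _ _).
have [s [us F0 sE]] := hs N.
have hd : cabs (\sum_(i <- s | i \notin B) FN N i) <= complex.Re e / 3.
  apply: (le_trans (cabs_sum _ _ _)); rewrite -big_filter.
  apply: le_trans (hA [seq i <- s | i \notin B] _ _).
  - by apply: ler_sum => i _.
  - by rewrite filter_uniq.
  - move=> i; rewrite mem_filter => /andP[iB _]; apply: contra iB.
    exact: (fsubsetP AB).
have -> : S - \sum_(i <- B) F i = (S - SN N) - (\sum_(i <- B) F i - \sum_(i <- B) FN N i)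
    + \sum_(i <- s | i \notin B) FN N i.
  by rewrite -sE (sumC_seq us (fset_uniq B) F0) /=; ring.
have := cabsD (S - SN N - (\sum_(i <- B) F i - \sum_(i <- B) FN N i))
  (\sum_(i <- s | i \notin B) FN N i).
have := cabsB (S - SN N) (\sum_(i <- B) F i - \sum_(i <- B) FN N i).
by lra.
Qed.

(* For [B] containing a suitable finite set, the sum over the orbit closure
   of [B] is its own opposite, and what is added to [B] is a negligible tail. *)
Lemma has_sum_antisym G F (sg : I -> I) : sumbounded G -> (forall i, cabs (F i) <= G i) ->
  involutive sg -> (forall i, F (sg i) = - F i) -> has_sum F 0.
Proof.
move=> bG FG sgK Fsg; apply: has_sumP => e e0.
have eE : e = (complex.Re e)%:C%C by rewrite RRe_real // gtr0_real.
have {}e0 : 0 < complex.Re e by rewrite -ltcR -eE.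
have [A hA] := sumbounded_tail bG e0.
exists A => B AB; rewrite eE cabs_le sub0r cabsN.
pose s := [seq i <- map sg (enum_fset B) | i \notin B].
have us : uniq s by rewrite filter_uniq // (map_inj_uniq (inv_inj sgK)) fset_uniq.
pose U := enum_fset B ++ s.
have uU : uniq U.
  rewrite cat_uniq us fset_uniq andbT /=; apply/hasPn => i.
  by rewrite mem_filter => /andP[].
have memU i : (i \in U) = (i \in B) || (sg i \in B).
  rewrite mem_cat mem_filter -[X in X \in map _ _](sgK i) (mem_map (inv_inj sgK)).
  by case: (i \in B).
have pU : perm_eq U (map sg U).
  apply: uniq_perm; rewrite ?(map_inj_uniq (inv_inj sgK)) // => i.
  by rewrite -[X in X \in map _ _](sgK i) (mem_map (inv_inj sgK)) !memU sgK orbC.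
have SU : \sum_(i <- U) F i = 0.
  have : \sum_(i <- U) F i = - \sum_(i <- U) F i.
    by rewrite {1}(perm_big _ pU) /= big_map -sumrN; apply: eq_bigr.
  move/eqP; rewrite -addr_eq0 -mulr2n mulrn_eq0 /= => /eqP //.
move: SU; rewrite big_cat /= => /eqP; rewrite addr_eq0 => /eqP ->.
rewrite cabsN; apply: (le_trans (cabs_sum _ _ _)).
apply: le_trans (hA s us _); first by apply: ler_sum.
move=> i; rewrite mem_filter => /andP[iB _]; apply: contra iB.
exact: (fsubsetP AB).
Qed.
End Summability.

(** * Summable geometric families on integer lattices *)

Section GeometricSums.
Variables (R : realType) (p : R).
Hypothesis p01 : 0 < p < 1.

Lemma geo_box_bound (M : nat) : \sum_(j < (M.*2).+1) p ^+ absz (j%:Z - M%:Z) <= 2 /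
  (1 - p).
Proof.
have /andP[p0 p1] := p01.
have geo n : \sum_(j < n) p ^+ j <= 1 / (1 - p).
  have -> : \sum_(j < n) p ^+ j = (1 - p ^+ n) / (1 - p).
    by apply: (canRL (mulfK _)); [lra|have := subrX1 p n; lra].
  rewrite ler_pM2r ?invr_gt0; last by lra.
  by have := exprn_ge0 n (ltW p0); lra.
have e : (M.*2).+1 = (M + M.+1)%N by rewrite -addnn addnS.
rewrite e big_split_ord /= (_ : 2 / (1 - p) = 1 / (1 - p) + 1 / (1 - p)); last by lra.
apply: lerD; last first.
  by apply: le_trans (geo M.+1); apply: ler_sum => j _; rewrite PoszD addrC addKr.
apply: le_trans (geo M); rewrite (reindex_inj rev_ord_inj) /=.
apply: ler_sum => j _.
have -> : absz ((M - j.+1)%N%:Z - M%:Z) = j.+1 by have := ltn_ord j; lia.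
by rewrite exprS ler_piMl ?exprn_ge0 // ltW.
Qed.

Lemma sumbounded_geo (r : nat) : sumbounded
  (fun k : {ffun 'I_r -> int} => \prod_(i < r) p ^+ absz (k i)).
Proof.
have /andP[p0 p1] := p01.
exists ((2 / (1 - p)) ^+ r) => s us.
pose M := \max_(k <- s) \max_(i < r) absz (k i).
have kM k i : k \in s -> (absz (k i) <= M)%N.
  move=> ks; rewrite /M (big_rem k) //= leq_max; apply/orP; left.
  exact: (leq_bigmax (F := fun i => absz (k i))).
(* The finite set lies in the box of radius [M], which [kshift] parametrises; over the whole box the
   sum factors into one-dimensional ones. *)
pose c (k : {ffun 'I_r -> int}) : {ffun 'I_r -> 'I_(M.*2).+1} :=
  [ffun i => inord (absz (k i + M%:Z))].
have cK k : k \in s -> kshift (c k) = k.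
  move=> ks; apply/ffunP => i; rewrite !ffunE.
  have := kM k i ks; move: (k i) => t tM.
  by rewrite inordK; lia.
pose g (k : {ffun 'I_r -> 'I_(M.*2).+1}) := \prod_(i < r) p ^+ absz (kshift k i).
have g0 k : 0 <= g k by apply: prodr_ge0 => i _; rewrite exprn_ge0 // ltW.
have -> : \sum_(k <- s) \prod_(i < r) p ^+ absz (k i) = \sum_(k <- map c s) g k.
  rewrite big_map !big_seq; apply: eq_bigr => k ks; rewrite /g cK //.
have uc : uniq (map c s).
  rewrite map_inj_in_uniq // => k k' ks ks' /(congr1 (@kshift _ _)).
  by rewrite !cK.
apply: (@le_trans _ _ (\sum_(k : {ffun 'I_r -> 'I_(M.*2).+1}) g k)).
  rewrite big_uniq //= [leRHS](bigID (mem (map c s))) /= lerDl.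
  exact: sumr_ge0.
rewrite /g.
have -> : \sum_(k : {ffun 'I_r -> 'I_(M.*2).+1}) \prod_(i < r) p ^+ absz (kshift k i)
   = \prod_(i < r) \sum_(j < (M.*2).+1) p ^+ absz (j%:Z - M%:Z).
  rewrite bigA_distr_bigA /=; apply: eq_bigr => k _; apply: eq_bigr => i _.
  by rewrite ffunE.
rewrite prodr_const card_ord; apply: lerXn2r; rewrite ?nnegrE.
- by apply: sumr_ge0 => j _; rewrite exprn_ge0 // ltW.
- by rewrite divr_ge0 //; lra.
- exact: geo_box_bound.
Qed.

(** The coordinates in which the summand decays. Slot [i0], whose difference would be zero, stores
    [|k|]. *)
Definition kdiff (r : nat) (i0 : 'I_r) (k : {ffun 'I_r -> int}) : {ffun 'I_r -> int} :=
  [ffun i => if i == i0 then zsum k else k i - k i0].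

(** The differences [k i - k i0] add up to [|k| - r (k i0)], which determines [k i0]. *)
Lemma kdiff_inj (r : nat) (i0 : 'I_r) : injective (kdiff i0).
Proof.
move=> k k' e.
have h i : k i - k i0 = k' i - k' i0.
  have := congr1 (fun f : {ffun 'I_r -> int} => f i) e; rewrite !ffunE.
  by case: eqP => // ->; rewrite !subrr.
have hs : zsum k = zsum k'.
  by have := congr1 (fun f : {ffun 'I_r -> int} => f i0) e; rewrite !ffunE eqxx.
have : \sum_i (k i - k i0) = \sum_i (k' i - k' i0) by apply: eq_bigr.
rewrite !sumrB -/(zsum k) -/(zsum k') hs !sumr_const card_ord => /addrI/oppr_inj.
move=> /eqP; rewrite eqrMn2r ?(gtn_eqF (leq_ltn_trans (leq0n i0) (ltn_ord i0))) //
  => /eqP h0.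
by apply/ffunP => i; have := h i; rewrite h0 => /addIr.
Qed.

Lemma sumbounded_kdiff (r : nat) (i0 : 'I_r) : sumbounded
  (fun k : {ffun 'I_r -> int} =>
    p ^+ absz (zsum k) * \prod_(i < r | i != i0) p ^+ absz (k i - k i0)).
Proof.
have [M hM] := sumbounded_geo r; exists M => s us.
have := hM (map (kdiff i0) s); rewrite (map_inj_uniq (@kdiff_inj _ i0)) => /(_ us).
rewrite big_map (eq_bigr (fun k : {ffun 'I_r -> int} =>
    p ^+ absz (zsum k) * \prod_(i < r | i != i0) p ^+ absz (k i - k i0))) // => k _.
rewrite (bigD1 i0) //= ffunE eqxx; congr (_ * _).
by apply: eq_bigr => i ii0; rewrite ffunE (negPf ii0).
Qed.
End GeometricSums.

(** * Factorization of the summand over pairs of indices *)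

Lemma big_pairs (T : Type) (idx : T) (op : Monoid.com_law idx) r (g : 'I_r -> 'I_r -> T) :
  \big[op/idx]_(i < r) \big[op/idx]_(j < r) g i j =
  op (\big[op/idx]_(i < r) g i i)
     (\big[op/idx]_(i < r) \big[op/idx]_(j < r | (i < j)%N) op (g i j) (g j i)).
Proof.
under [X in op _ X]eq_bigr do rewrite big_split /=.
rewrite big_split /= [X in op _ (op _ X)](exchange_big_dep xpredT) //= -!big_split /=.
apply: eq_bigr => i _; rewrite (bigD1 i) //=; congr (op _ _).
rewrite (bigID (fun j : 'I_r => i < j)%N) /=; congr (op _ _); apply: eq_bigl => j.
  by rewrite -val_eqE /=; case: ltngtP.
by rewrite -val_eqE /=; case: ltngtP.
Qed.

Section PairFactorization.
Variables (F : fieldType) (q z : F) (r : nat) (x : 'I_r -> F).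
Hypothesis q0 : q != 0.
Hypothesis x0 : forall i, x i != 0.

Definition pairfactor (s t : F) (d : int) :=
  (s * q ^ d - t) / (s - t) * q ^ zbin2 d * (s / t) ^ d.

Definition jtpterm (n : int) := (-1) ^ n * q ^ (n + zbin2 n) * z ^ n.

Lemma prod_expz_pairs (k : {ffun 'I_r -> int}) :
  \prod_(i < r) x i ^ (r%:Z * k i - zsum k) =
  \prod_(i < r) \prod_(j < r | (i < j)%N) (x i / x j) ^ (k i - k j).
Proof.
transitivity (\prod_(i < r) \prod_(j < r) x i ^ (k i - k j)).
  apply: eq_bigr => i _.
  have -> : r%:Z * k i - zsum k = \sum_(j < r) (k i - k j).
    by rewrite sumrB sumr_const card_ord pmulrn mulrzz mulrC.
  rewrite (big_morph (fun e : int => x i ^ e) (id1 := 1) (op1 := *%R)) //.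
  by move=> m n; rewrite expfzDr.
rewrite big_pairs /= big1 ?mul1r => [|i _]; last by rewrite subrr.
apply: eq_bigr => i _; apply: eq_bigr => j _.
by rewrite expfzMl exprz_inv opprB.
Qed.

(** The quadratic part is Lagrange's identity: [r] times the sum of the [(k i)^2] is [|k|^2] plus
    the sum over [i < j] of [(k i - k j)^2]. The double sum of [k j] accounts for the powers
    [q^(k j)] extracted from the Vandermonde factors. *)
Lemma sum_zbin2_pairs (k : {ffun 'I_r -> int}) :
  \sum_(i < r) \sum_(j < r | (i < j)%N) (k j) + r%:Z * \sum_(i < r) zbin2 (k i) =
  zbin2 (zsum k) + \sum_(i < r) \sum_(j < r | (i < j)%N) zbin2 (k i - k j).
Proof.
have h := big_pairs +%R (fun i j : 'I_r => zbin2 (k i) * 2 - k i * k j).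
have {h} : (\sum_(i < r) \sum_(j < r) (zbin2 (k i) * 2 - k i * k j))%R =
    (\sum_(i < r) (zbin2 (k i) * 2 - k i * k i) +
     \sum_(i < r) \sum_(j < r | (i < j)%N)
       ((zbin2 (k i) * 2 - k i * k j) + (zbin2 (k j) * 2 - k j * k i)))%R := h.
have -> : (\sum_(i < r) \sum_(j < r) (zbin2 (k i) * 2 - k i * k j))%R =
    r%:Z * (\sum_i zbin2 (k i)) * 2 - zsum k * zsum k.
  rewrite (eq_bigr (fun i => r%:Z * zbin2 (k i) * 2 - k i * zsum k)) => [|i _].
    by rewrite sumrB -mulr_suml -mulr_suml -mulr_sumr.
  by rewrite sumrB sumr_const card_ord pmulrn mulrzz -mulr_sumr -/(zsum k); ring.
have -> : (\sum_(i < r) (zbin2 (k i) * 2 - k i * k i))%R = - zsum k.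
  by rewrite /zsum -sumrN; apply: eq_bigr => i _; rewrite zbin2M2; ring.
have -> : \sum_(i < r) \sum_(j < r | (i < j)%N)
      (zbin2 (k i) * 2 - k i * k j + (zbin2 (k j) * 2 - k j * k i)) =
    \sum_(i < r) ((\sum_(j < r | (i < j)%N) zbin2 (k i - k j)) * 2 -
      (\sum_(j < r | (i < j)%N) k j) * 2).
  apply: eq_bigr => i _; rewrite !mulr_suml -sumrB; apply: eq_bigr => j _.
  by rewrite !zbin2M2; ring.
rewrite sumrB -!mulr_suml => h.
have := zbin2M2 (zsum k); move: h.
set A := \sum_(i < r) zbin2 _; set B := \sum_i \sum_(j < r | _) zbin2 _.
set D := \sum_i \sum_(j < r | _) k j; set n := zsum k => h h2.
suff : (D + r%:Z * A) * 2 = (zbin2 n + B) * 2 by lia.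
rewrite !mulrDl h2; move: h; set t := r%:Z * A; lia.
Qed.

(* Apart from the terms of the Jacobi triple product, the summand only depends
   on the differences [k i - k j], with Gaussian decay in each of them. *)
Lemma armono_factor (k : {ffun 'I_r -> int}) :
  armono q z x k = (-1) ^ (r%:Z * zsum k - zsum k) *
   (\prod_(i < r) \prod_(j < r | (i < j)%N) pairfactor (x i) (x j) (k i - k j)) *
   jtpterm (zsum k).
Proof.
rewrite /armono /jtpterm prod_expz_pairs.
have -> : \prod_(i < r) \prod_(j < r | (i < j)%N) pairfactor (x i) (x j) (k i - k j) =
   (\prod_(i < r) \prod_(j < r | (i < j)%N) ((x i * q ^ k i - x j * q ^ k j) / (x i
     - x j)))
   * q ^ (- \sum_(i < r) \sum_(j < r | (i < j)%N) k j)
   * q ^ (\sum_(i < r) \sum_(j < r | (i < j)%N) zbin2 (k i - k j))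
   * \prod_(i < r) \prod_(j < r | (i < j)%N) (x i / x j) ^ (k i - k j).
  have hm (P : 'I_r -> pred 'I_r) (f : 'I_r -> 'I_r -> int) :
      q ^ (\sum_(i < r) \sum_(j < r | P i j) f i j)
        = \prod_(i < r) \prod_(j < r | P i j) q ^ f i j.
    have m := fun s t => expfzDr s t q0.
    rewrite (big_morph (fun e : int => q ^ e) m (id1 := 1)) //.
    by apply: eq_bigr => i _; rewrite (big_morph (fun e : int => q ^ e) m (id1 := 1)).
  rewrite -sumrN (eq_bigr (fun i : 'I_r => \sum_(j < r | (i < j)%N) - k j)) => [|i _];
    last by rewrite sumrN.
  rewrite !hm -!big_split /=; apply: eq_bigr => i _.
  rewrite -!big_split /=; apply: eq_bigr => j _; rewrite /pairfactor.
  congr (_ * _ * _); rewrite expfzB // -invr_expz.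
  have kj0 : q ^ k j != 0 by apply: expfz_neq0.
  rewrite [RHS]mulrAC; congr (_ * _).
  by field.
have := sum_zbin2_pairs k.
set A := \sum_(i < r) zbin2 _; set B := \sum_i \sum_(j < r | _) zbin2 _.
set D := \sum_i \sum_(j < r | _) k j; set n := zsum k.
move=> h; have m1 : (-1 : F) != 0 by rewrite oppr_eq0 oner_eq0.
have -> : (-1) ^ (r%:Z * n) = (-1) ^ (r%:Z * n - n) * (-1) ^ n :> F.
  by rewrite -expfzDr // subrK.
have -> : q ^ (n + r%:Z * A) = q ^ (- D) * q ^ B * q ^ (n + zbin2 n).
  by rewrite -!expfzDr //; congr (_ ^ _); move: h; set t := r%:Z * A; lia.
ring.
Qed.
End PairFactorization.

(** * Gaussian decay in the differences *)

Section TermBounds.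
Variable R : realType.

Lemma geo_prod_bounded (p c rho : R) : 0 <= p < 1 -> 0 <= c -> 0 < rho ->
  exists C : R, 0 < C /\ forall n (t : 'I_n -> R[i]),
    (forall j, cabs (t j) <= rho + c * p ^+ j) -> cabs (\prod_(j < n) t j) <= C *
      rho ^+ n.
Proof.
move=> p01 c0 rho0; have cr0 : 0 <= c / rho by rewrite divr_ge0 // ltW.
have [C [C0 hC]] := prod1D_bounded cr0 p01.
exists C; split=> // n t ht; rewrite cabs_prod.
apply: (@le_trans _ _ (\prod_(j < n) ((1 + c / rho * p ^+ j) * rho))).
  apply: ler_prod => j _; rewrite cabs_ge0 /= (le_trans (ht j)) //.
  have r0 : rho != 0 by rewrite gt_eqF.
  by rewrite [leRHS](_ : _ = rho + c * p ^+ j) //; field.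
by rewrite big_split /= prodr_const card_ord ler_wpM2r ?hC // exprn_ge0 // ltW.
Qed.

(** Each [v p^j] is below [1 + v p^j], so [p^C(n,2) v^n] is below a bounded product, and no
    maximisation over [d] is needed. Negative [d] uses [v^-1], with an additional power of [p] that
    is at most one. *)
Lemma gauss_bounded (p v : R) : 0 < p < 1 -> 0 < v ->
  exists C : R, 0 < C /\ forall d : int, p ^ zbin2 d * v ^ d <= C.
Proof.
move=> /andP[p0 p1] v0.
have p01 : 0 <= p < 1 by rewrite ltW.
have [C [C0 hC]] := prod1D_bounded (ltW v0) p01.
have vi0 : 0 <= v^-1 by rewrite invr_ge0 ltW.
have [D [D0 hD]] := prod1D_bounded vi0 p01.
exists (C + D); split=> [|d]; first exact: addr_gt0.
have h (w : R) n : 0 <= w -> p ^+ 'C(n, 2) * w ^+ n <= \prod_(j < n) (1 + w * p ^+ j).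
  move=> w0; rewrite -triangular_sum big_mkord -prodrXr.
  have -> : w ^+ n = \prod_(j < n) w by rewrite prodr_const card_ord.
  rewrite -big_split /=; apply: ler_prod => j _.
  by rewrite [p ^+ j * w]mulrC mulr_ge0 ?exprn_ge0 ?(ltW p0) //= lerDr ler01.
case: d => n.
  rewrite zbin2_nat -!exprnP; have := h v n (ltW v0); have := hC n; lra.
have -> : zbin2 (Negz n) = ('C(n.+1, 2) + n.+1)%N%:Z.
  have h1 := zbin2M2 (Negz n); have h2 := zbin2M2 n.+1; have := zbin2_nat n.+1.
  by nia.
rewrite NegzE -exprnN -!exprnP exprD -exprVn.
have := h v^-1 n.+1 vi0; have := hD n.+1.
have : p ^+ 'C(n.+1, 2) * p ^+ n.+1 * v^-1 ^+ n.+1 <= p ^+ 'C(n.+1, 2) * v^-1 ^+ n.+1.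
  rewrite ler_wpM2r ?exprn_ge0 // ler_piMr ?exprn_ge0 ?ltW //.
  by rewrite exprn_ilt1 // ltW.
lra.
Qed.

Lemma gauss_geo (p v rho : R) : 0 < p < 1 -> 0 < v -> 0 < rho < 1 ->
  exists C : R, 0 < C /\ forall d : int, p ^ zbin2 d * v ^ d <= C * rho ^+ absz d.
Proof.
move=> p01 v0 /andP[r0 r1].
(* Geometric decay is gained by moving [rho] into the base: [v / rho] serves [d >= 0] and [v rho]
   serves [d < 0]. *)
have [C [C0 hC]] := gauss_bounded p01 (divr_gt0 v0 r0).
have [D [D0 hD]] := gauss_bounded p01 (mulr_gt0 v0 r0).
have rn0 : rho != 0 by rewrite gt_eqF.
exists (C + D); split=> [|d]; first exact: addr_gt0.
rewrite mulrDl; case: d => n.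
  have := hC n; rewrite -!exprnP expr_div_n => h.
  have : p ^ zbin2 n * v ^+ n <= C * rho ^+ n.
    by rewrite -ler_pdivrMr ?exprn_gt0 // -mulrA.
  have : 0 <= D * rho ^+ n by rewrite mulr_ge0 ?exprn_ge0 ?ltW.
  by rewrite /=; lra.
have := hD (Negz n); rewrite NegzE -!exprnN exprMn invfM => h.
have : p ^ zbin2 (- n.+1%:Z) * (v ^+ n.+1)^-1 <= D * rho ^+ n.+1.
  by rewrite -ler_pdivrMr ?exprn_gt0 // -mulrA.
have : 0 <= C * rho ^+ n.+1 by rewrite mulr_ge0 ?exprn_ge0 ?ltW.
by rewrite abszN /=; lra.
Qed.

Variable q : R[i].
Hypothesis q0 : q != 0.
Hypothesis q1 : cabs q < 1.

Lemma cabs_q_pos : 0 < cabs q < 1. Proof. by rewrite cabs_gt0 q0. Qed.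

Lemma pairfactor_bounded (rho : R) (s t : R[i]) : 0 < rho < 1 -> s != 0 -> t != 0 ->
  exists C : R, 0 < C /\ forall d, cabs (pairfactor q s t d) <= C * rho ^+ absz d.
Proof.
move=> rho01 s0 t0; have p01 := cabs_q_pos.
have w0 : 0 < cabs (s / t) by rewrite cabs_gt0 mulf_neq0 ?invr_eq0.
have p0 : 0 < cabs q by rewrite cabs_gt0.
have [C [C0 hC]] := gauss_geo p01 w0 rho01.
(* The additional factor [|q|] in the base absorbs the [q^d] of [s q^d - t]. *)
have [D [D0 hD]] := gauss_geo p01 (mulr_gt0 w0 p0) rho01.
pose g := cabs (s - t)^-1.
have g0 : 0 <= g by apply: cabs_ge0.
(* The summand [1] keeps the constant positive when [s = t], where [(s - t)^-1] is [0] by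
   convention; the uniform bound over all pairs includes the diagonal. *)
exists ((cabs s * D + cabs t * C) * g + 1); split=> [|d].
  by rewrite ltr_wpDl // mulr_ge0 // addr_ge0 // mulr_ge0 ?cabs_ge0 // ltW.
have rd0 : 0 <= rho ^+ absz d by rewrite exprn_ge0 //; case/andP: rho01 => /ltW.
apply: (@le_trans _ _ ((cabs s * D + cabs t * C) * g * rho ^+ absz d)); last first.
  by rewrite ler_wpM2r // lerDl.
rewrite /pairfactor 3!cabsM -/g 2!cabsXz.
have Q0 : 0 <= cabs q ^ zbin2 d * cabs (s / t) ^ d
  by rewrite mulr_ge0 // exprz_ge0 ?cabs_ge0.
have := cabsB (s * q ^ d) t; rewrite cabsM cabsXz => h.
have e1 := hC d; have e2 := hD d; move: e2; rewrite expfzMl => e2.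
set Q := cabs q ^ zbin2 d in Q0 e1 e2 *; set W := cabs (s / t) ^ d in Q0 e1 e2 *.
apply: (@le_trans _ _ ((cabs s * cabs q ^ d + cabs t) * g * Q * W)).
  by rewrite -!mulrA ler_wpM2r // mulr_ge0.
have s0' := cabs_ge0 s; have t0' := cabs_ge0 t.
have -> : (cabs s * cabs q ^ d + cabs t) * g * Q * W =
  (cabs s * (Q * (W * cabs q ^ d)) + cabs t * (Q * W)) * g by ring.
have -> : (cabs s * D + cabs t * C) * g * rho ^+ absz d =
  (cabs s * (D * rho ^+ absz d) + cabs t * (C * rho ^+ absz d)) * g by ring.
by rewrite ler_wpM2r // lerD // ler_wpM2l.
Qed.
End TermBounds.

(** * Geometric decay in the sum of the indices *)

Section Domination.
Variables (R : realType) (q a b z : R[i]).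
Hypothesis q0 : q != 0.
Hypothesis q1 : cabs q < 1.
Hypothesis z0 : z != 0.

Lemma cabs_qX_le1 n : cabs (q ^+ n) <= 1.
Proof. by rewrite cabsX exprn_ile1 ?cabs_ge0 // ltW. Qed.

(** The Gaussian factor is spent on the growing symbol; what is left is [n] factors, each within a
    multiple of [|q|^j] of [a z]. *)
Lemma jtpterm_pos (n : nat) :
  jtpterm q z n * qpoch q (a * q ^ (- n%:Z) + b) n =
  \prod_(j < n) (z * (a + b * q ^+ n - q ^+ j.+1)).
Proof.
have qn0 : q ^+ n != 0 by apply: expf_neq0.
rewrite big_split /= prodr_const card_ord -/(rothe_base q a b n) rothe_base_qpoch //.
have -> : (a + b * q ^+ n) / q ^+ n = a * q ^ (- n%:Z) + b.
  by rewrite -exprnN; field.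
rewrite /jtpterm zbin2_nat binS bin1 -PoszD -!exprnP addnC; ring.
Qed.

(** The counterpart for negative index: here the [m] factors approach [b] in modulus. *)
Lemma jtpterm_neg (m : nat) :
  jtpterm q z (- m%:Z) * qpoch q (z * q * (a + b * q ^ (- m%:Z))) m =
  \prod_(l < m) (- (q ^+ l / z - a * q ^+ m - b)).
Proof.
rewrite /jtpterm.
have -> : - m%:Z + zbin2 (- m%:Z) = 'C(m, 2)%:Z.
  have h1 := zbin2M2 (- m%:Z); have h2 := zbin2M2 m; have := zbin2_nat m.
  by nia.
rewrite -!exprnN -exprnP -[z ^- m]exprVn -[(-1) ^- m]exprVn invrN1 /qpoch
  -triangular_sum big_mkord -prodrXr.
rewrite -[in (-1) ^+ m](card_ord m) -prodr_const -[in z^-1 ^+ m](card_ord m) -prodr_const.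
rewrite [X in _ * X](reindex_inj rev_ord_inj) /= -!big_split /=.
apply: eq_bigr => l _.
have -> : q ^+ m = q ^+ (m - l.+1) * q ^+ l * q.
  by rewrite -exprD -exprSr; congr (_ ^+ _); have := ltn_ord l; lia.
have h1 : q ^+ l != 0 by apply: expf_neq0.
have h2 : q ^+ (m - l.+1) != 0 by apply: expf_neq0.
by field; rewrite h1 h2 q0 z0.
Qed.

Lemma tail_bounded (rho : R) : 0 < rho -> cabs (a * z) <= rho -> cabs b <= rho ->
  exists C : R, 0 < C /\ forall (L : nat) (n : int), (absz n <= L)%N ->
    cabs (jtpterm q z n * tailpoch q a b z L n) <= C * rho ^+ absz n.
Proof.
move=> rho0 haz hb; have p01 := cabs_q01 q1.
have [|C1 [C10 hC1]] := @geo_prod_bounded R (cabs q) (cabs (b * z) + cabs z) rho p01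
  _ rho0.
  by rewrite addr_ge0 ?cabs_ge0.
have [|C2 [C20 hC2]] := @geo_prod_bounded R (cabs q) (cabs z^-1 + cabs a) rho p01 _ rho0.
  by rewrite addr_ge0 ?cabs_ge0.
have ab0 : 0 <= cabs a + cabs b by rewrite addr_ge0 ?cabs_ge0.
have [U [U0 hU]] := qpoch_bounded q1 ab0.
have [V [V0 hV]] := qpoch_bounded q1 (mulr_ge0 (cabs_ge0 z) ab0).
pose W := V + cabs (z * a) * 2 * V.
have W0 : 0 < W.
  by rewrite /W ltr_pwDl // mulr_ge0 ?mulr_ge0 ?cabs_ge0 // ltW.
have hW v e e' c : cabs v <= cabs z * (cabs a + cabs b) ->
    cabs (qpoch q v e - z * a * (1 - q ^+ c) * qpoch q v e') <= W.
  move=> hv; apply: (le_trans (cabsB _ _)); apply: lerD; first exact: hV.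
  rewrite !cabsM; apply: ler_pM; rewrite ?mulr_ge0 ?cabs_ge0 //; last exact: hV.
  rewrite ler_wpM2l ?mulr_ge0 ?cabs_ge0 //.
  by have := cabsB 1 (q ^+ c); have := cabs_qX_le1 c; rewrite cabs1; lra.
have le_ab s t : cabs s <= 1 -> cabs t <= 1 -> cabs (a * s + b * t) <= cabs a + cabs b.
  move=> hs ht; apply: (le_trans (cabsD _ _)); rewrite !cabsM.
  by apply: lerD; rewrite ler_piMr ?cabs_ge0.
have le_z y : cabs y <= cabs a + cabs b -> cabs (z * q * y) <= cabs z * (cabs a + cabs b).
  move=> hy; rewrite !cabsM; apply: ler_pM; rewrite ?mulr_ge0 ?cabs_ge0 //.
  by rewrite ler_piMr ?cabs_ge0 // ltW.
exists ((C1 + C2) * U * W); split=> [|L n nL].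
  by rewrite !mulr_gt0 // addr_gt0.
have CUW D : D <= C1 + C2 -> D * rho ^+ absz n * U * W <= (C1 + C2) * U * W * rho ^+
  absz n.
  move=> hD; have -> : (C1 + C2) * U * W * rho ^+ absz n
    = (C1 + C2) * rho ^+ absz n * U * W by ring.
  by rewrite !ler_wpM2r // ?exprn_ge0 // ltW.
rewrite /tailpoch; case: n nL CUW => n nL CUW.
  apply: le_trans (CUW C1 _); last by rewrite lerDl ltW.
  have -> : absz (L%:Z + n%:Z) = (n + L)%N by rewrite -PoszD addnC.
  (* The first [n] factors are merged with [jtpterm]. The remaining symbol starts at [a + b q^n], so
     it is bounded independently of [n] and [L]. *)
  rewrite qpochD !mulrA jtpterm_pos !cabsM.
  have un : (a * q ^ (- n%:Z) + b) * q ^+ n = a * 1 + b * q ^+ n.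
    have qn0 : q ^+ n != 0 by apply: expf_neq0.
    by rewrite -exprnN; field.
  rewrite un; apply: ler_pM; rewrite ?mulr_ge0 ?cabs_ge0 //; last first.
    apply: hW; apply: le_z; rewrite -exprnP -[X in X + _]mulr1.
    by apply: le_ab; rewrite ?cabs1 // cabs_qX_le1.
  apply: ler_pM; rewrite ?cabs_ge0 //; last first.
    by apply: hU; apply: le_ab; rewrite ?cabs1 // cabs_qX_le1.
  apply: hC1 => j.
  have -> : z * (a + b * q ^+ n - q ^+ j.+1) = a * z + (b * z * q ^+ n - z * q ^+ j.+1)
    by ring.
  apply: (le_trans (cabsD _ _)); apply: lerD => //.
  apply: (le_trans (cabsB _ _)); rewrite mulrDl !cabsM !cabsX.
  have le_e e : (j <= e)%N -> cabs q ^+ e <= cabs q ^+ j.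
    by move=> je; apply: ler_wiXn2l => //; [exact: cabs_ge0|exact: ltW].
  apply: lerD; rewrite ler_wpM2l ?mulr_ge0 ?cabs_ge0 // le_e //.
  by rewrite ltnW // ltn_ord.
apply: le_trans (CUW C2 _); last by rewrite lerDr ltW.
rewrite NegzE; set m := n.+1 in nL CUW *.
have -> : absz (L%:Z - - m%:Z) = (m + L)%N by rewrite opprK -PoszD addnC.
have -> : absz (L%:Z + - m%:Z) = (L - m)%N by lia.
(* [L] is positive here, since [0 < m <= L]; hence the shorter symbol also contains the first [m]
   factors. *)
have -> : (m + L).-1 = (m + L.-1)%N by move: nL; rewrite /m; lia.
rewrite !qpochD opprK -exprnP.
set v := z * q * (a + b * q ^ (- m%:Z)).
have -> : jtpterm q z (- m%:Z) * (qpoch q (a * q ^+ m + b) (L - m) *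
    (qpoch q v m * qpoch q (v * q ^+ m) L - z * a * (1 - q ^+ (m + L)) *
      (qpoch q v m * qpoch q (v * q ^+ m) L.-1))) =
  (jtpterm q z (- m%:Z) * qpoch q v m) * qpoch q (a * q ^+ m + b) (L - m) *
  (qpoch q (v * q ^+ m) L - z * a * (1 - q ^+ (m + L)) * qpoch q (v * q ^+ m) L.-1).
  by ring.
have qm0 : q ^+ m != 0 by apply: expf_neq0.
have vm : v * q ^+ m = z * q * (a * q ^+ m + b * 1).
  by rewrite /v -exprnN; field.
rewrite vm jtpterm_neg !cabsM; apply: ler_pM; rewrite ?mulr_ge0 ?cabs_ge0 //; last first.
  by apply/hW/le_z/le_ab; rewrite ?cabs1 // cabs_qX_le1.
apply: ler_pM; rewrite ?cabs_ge0 //; last first.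
  by rewrite -[X in _ + X]mulr1; apply/hU/le_ab; rewrite ?cabs1 // cabs_qX_le1.
apply: hC2 => j; rewrite cabsN.
have -> : q ^+ j / z - a * q ^+ m - b = (z^-1 * q ^+ j - a * q ^+ m) - b by ring.
apply: (le_trans (cabsB _ _)); rewrite addrC; apply: lerD => //.
apply: (le_trans (cabsB _ _)); rewrite mulrDl !cabsM !cabsX.
rewrite lerD2l ler_wpM2l ?cabs_ge0 //.
by apply: ler_wiXn2l; [exact: cabs_ge0|exact: ltW|rewrite ltnW // ltn_ord].
Qed.
End Domination.

(** * Antisymmetry of the summand for degenerate parameters *)

Section DegenerateParameters.
Variables (F : fieldType) (q z : F) (r : nat) (x : 'I_r -> F).
Hypothesis q0 : q != 0.
Hypothesis x0 : forall i, x i != 0.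

Lemma vdm_tperm (y : 'I_r -> F) (i j : 'I_r) : i != j ->
  vdm (fun l => y (tperm i j l)) = - vdm y.
Proof.
move=> ij.
(* The sign change of the entries reconciles the two orders of subtraction; the transposition
   becomes a swap of columns. *)
have vE (w : 'I_r -> F) : vdm w = \det (Vandermonde r (\row_l (- w l))).
  rewrite det_Vandermonde; apply: eq_bigr => l _; apply: eq_bigr => l' _.
  by rewrite !mxE opprK addrC.
rewrite !vE.
have -> : Vandermonde r (\row_l (- y (tperm i j l))) =
    col_perm (tperm i j) (Vandermonde r (\row_l (- y l))).
  by apply/matrixP => s t; rewrite !mxE.
by rewrite col_permE det_mulmx det_perm odd_permV odd_tperm ij expr1 mulrN1.
Qed.

(** When [x j = x i q^n], the shifts by [n] give [x i q^(k j + n) = x j q^(k j)] and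
    [x j q^(k i - n) = x i q^(k i)]. *)
Definition kswap (i j : 'I_r) (n : nat) (k : {ffun 'I_r -> int}) : {ffun 'I_r -> int} :=
  [ffun l => if l == i then k j + n%:Z else if l == j then k i - n%:Z else k l].

Lemma big_two (T : Type) (idx : T) (op : Monoid.com_law idx) (i j : 'I_r) (f : 'I_r
  -> T) :
  i != j -> \big[op/idx]_l f l =
  op (op (f i) (f j)) (\big[op/idx]_(l < r | (l != i) && (l != j)) f l).
Proof. by move=> ij; rewrite (bigD1 i) //= (bigD1 j) 1?eq_sym //= Monoid.mulmA. Qed.

Lemma kswapK i j n : i != j -> involutive (kswap i j n).
Proof.
move=> ij k; apply/ffunP => l; rewrite !ffunE !eqxx.
have -> : (j == i) = false by rewrite eq_sym (negPf ij).
have [->|li] := eqVneq l i; first by rewrite subrK.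
by have [->|lj] := eqVneq l j; first by rewrite addrK.
Qed.

Lemma kswap_i i j n k : kswap i j n k i = k j + n%:Z.
Proof. by rewrite ffunE eqxx. Qed.

Lemma kswap_j i j n k : i != j -> kswap i j n k j = k i - n%:Z.
Proof. by move=> ij; rewrite ffunE eqxx [j == i]eq_sym (negPf ij). Qed.

Lemma kswap_id i j n k l : l != i -> l != j -> kswap i j n k l = k l.
Proof. by move=> /negPf li /negPf lj; rewrite ffunE li lj. Qed.

Lemma zsum_kswap i j n k : i != j -> zsum (kswap i j n k) = zsum k.
Proof.
move=> ij; rewrite /zsum !(big_two _ _ ij) /= kswap_i kswap_j //.
congr (_ + _); last by apply: eq_bigr => l /andP[li lj]; rewrite kswap_id.
by ring.
Qed.

(** The sign comes from the Vandermonde product. The rest depends on [k] only through [|k|] and the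
    [r]-th power of the product of the [q^(zbin2 (k l)) (x l)^(k l)], both of which are
    invariant. *)
Lemma armono_kswap i j n k : i != j -> x i * q ^+ n = x j ->
  armono q z x (kswap i j n k) = - armono q z x k.
Proof.
move=> ij xij; rewrite !armonoE zsum_kswap //.
have -> : vdm (fun l => x l * q ^ kswap i j n k l) = - vdm (fun l => x l * q ^ k l).
  rewrite -(vdm_tperm _ ij) /vdm; apply: eq_bigr => s _; apply: eq_bigr => t _.
  suff h l : x l * q ^ kswap i j n k l = x (tperm i j l) * q ^ k (tperm i j l)
    by rewrite !h.
  case: tpermP => [->|->|/eqP li /eqP lj].
  - by rewrite kswap_i addrC expfzDr // mulrA -exprnP xij.
  - by rewrite kswap_j // -xij addrC expfzDr // -invr_expz mulrA -exprnP mulfK //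
    expf_neq0.
  - by rewrite kswap_id.
have hE k' : q ^ (zsum k + r%:Z * \sum_i zbin2 (k' i)) * \prod_(i < r) x i ^ (r%:Z *
  k' i - zsum k)
    = q ^ zsum k * (\prod_i (q ^ zbin2 (k' i) * x i ^ k' i)) ^ r%:Z * \prod_(i < r)
      x i ^ (- zsum k).
  rewrite expfzDr // -!mulrA; congr (_ * _).
  rewrite -exprnP -prodrXl mulr_sumr (big_morph (fun e : int => q ^ e) (id1 := 1)
    (fun s t => expfzDr s t q0)) // -!big_split /=.
  apply: eq_bigr => l _; rewrite exprMn !exprnP !exprz_exp expfzDr //.
  by rewrite ![_ * r%:Z]mulrC mulrA.
have hh : \prod_l (q ^ zbin2 (kswap i j n k l) * x l ^ kswap i j n k l) =
    \prod_l (q ^ zbin2 (k l) * x l ^ k l).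
  rewrite !(big_two _ _ ij) /=; congr (_ * _); last first.
    by apply: eq_bigr => l /andP[li lj]; rewrite kswap_id.
  rewrite kswap_i kswap_j // -xij exprnP !expfzMl !exprz_exp.
  have -> : q ^ zbin2 (k j + n%:Z) * x i ^ (k j + n%:Z) * (q ^ zbin2 (k i - n%:Z) *
    (x i ^ (k i - n%:Z) * q ^ (n%:Z * (k i - n%:Z)))) =
    (q ^ zbin2 (k j + n%:Z) * q ^ zbin2 (k i - n%:Z) * q ^ (n%:Z * (k i - n%:Z))) *
    (x i ^ (k j + n%:Z) * x i ^ (k i - n%:Z)) by ring.
  have -> : q ^ zbin2 (k i) * x i ^ k i * (q ^ zbin2 (k j) * (x i ^ k j * q ^ (n%:Z
    * k j))) =
    (q ^ zbin2 (k i) * q ^ zbin2 (k j) * q ^ (n%:Z * k j)) * (x i ^ k i * x i ^ k j)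
      by ring.
  rewrite -!expfzDr //; congr (_ ^ _ * _ ^ _); last by ring.
  have h1 := zbin2M2 (k j + n%:Z); have h2 := zbin2M2 (k i - n%:Z).
  have h3 := zbin2M2 (k i); have h4 := zbin2M2 (k j).
  suff : 2 * (zbin2 (k j + n%:Z) + zbin2 (k i - n%:Z) + n%:Z * (k i - n%:Z)) =
     2 * (zbin2 (k i) + zbin2 (k j) + n%:Z * k j) by lia.
  rewrite !mulrDr ![2 * zbin2 _]mulrC h1 h2 h3 h4; ring.
have h1 := hE k; have h2 := hE (kswap i j n k); rewrite hh -h1 in h2.
by rewrite !mulNr -!mulrA; congr (- (_ * (_ * (_ * _)))); rewrite mulrCA h2 mulrCA.
Qed.
End DegenerateParameters.

(** * Passage to the limit in the terminating identity *)

Lemma uniform_bound (R : realType) (m : nat) (T : Type) (P : 'I_m -> T -> R) :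
  (forall i, exists C : R, 0 < C /\ forall t, P i t <= C) ->
  exists C : R, 0 < C /\ forall i t, P i t <= C.
Proof.
elim: m P => [|m IH] P hP; first by exists 1; split=> // -[].
have [C [C0 hC]] := IH _ (fun i => hP (lift ord0 i)); have [D [D0 hD]] := hP ord0.
exists (C + D); split=> [|i t]; first exact: addr_gt0.
have [->|i0] := eqVneq i ord0; first by rewrite (le_trans (hD t)) // lerDr ltW.
have [j ->] : exists j, i = lift ord0 j by case: (unliftP ord0 i) i0 => [j ->|->];
  [exists j|rewrite eqxx].
by rewrite (le_trans (hC j t)) // lerDl ltW.
Qed.

Section MainSum.
Variables (R : realType) (r : nat) (q a b z : R[i]) (x : 'I_r -> R[i]).
Hypothesis r0 : (0 < r)%N.
Hypothesis q0 : q != 0.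
Hypothesis q1 : cabs q < 1.
Hypothesis z0 : z != 0.
Hypothesis az1 : 1 - a * z != 0.
Hypothesis az_lt1 : cabs (a * z) < 1.
Hypothesis b_lt1 : cabs b < 1.
Hypothesis x0 : forall i, x i != 0.
Implicit Type k : {ffun 'I_r -> int}.

(** The midpoint to [1] is still below [1], and it is positive even if [a z] and [b] both vanish, as
    the divisions by its powers require. *)
Definition rate : R := (1 + Num.max (cabs (a * z)) (cabs b)) / 2.

Lemma rate_bounds : [/\ 0 < rate < 1, cabs (a * z) <= rate & cabs b <= rate].
Proof.
rewrite /rate; have := cabs_ge0 b; have := b_lt1; have := az_lt1;
  have := cabs_ge0 (a * z).
by case: (leP (cabs (a * z)) (cabs b)) => *; split; lra.
Qed.

Definition majorant k : R := rate ^+ absz (zsum k) *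
  \prod_(i < r | i != Ordinal r0) rate ^+ absz (k i - k (Ordinal r0)).

Lemma majorant_ge0 k : 0 <= majorant k.
Proof.
have [/andP[/ltW h _] _ _] := rate_bounds.
by rewrite mulr_ge0 ?exprn_ge0 //; apply: prodr_ge0 => i _; rewrite exprn_ge0.
Qed.

Lemma pairs_bounded : exists C : R, 0 < C /\ forall k,
  cabs (\prod_(i < r) \prod_(j < r | (i < j)%N) pairfactor q (x i) (x j) (k i - k j)) <=
  C * \prod_(i < r | i != Ordinal r0) rate ^+ absz (k i - k (Ordinal r0)).
Proof.
have [rho01 _ _] := rate_bounds; have /andP[rho0 rho1] := rho01.
have [C [C0 hC]] : exists C : R, 0 < C /\ forall i (t : 'I_r * int),
    cabs (pairfactor q (x i) (x t.1) t.2) / rate ^+ absz t.2 <= C.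
  apply: uniform_bound => i.
  have [C [C0 hC]] : exists C : R, 0 < C /\ forall j (d : int),
      cabs (pairfactor q (x i) (x j) d) / rate ^+ absz d <= C.
    apply: uniform_bound => j.
    have [C [C0 hC]] := pairfactor_bounded q0 q1 rho01 (x0 i) (x0 j).
    by exists C; split=> // d; rewrite ler_pdivrMr ?exprn_gt0.
  by exists C; split=> // -[j d]; apply: hC.
exists (\prod_(i < r) \prod_(j < r | (i < j)%N) C); split=> [|k].
  by apply: prodr_gt0 => i _; apply: prodr_gt0.
rewrite cabs_prod.
(* Decay is kept only for the pairs containing the first index and bounded by a constant for the
   others: these [r - 1] differences and [|k|] already control [k]. *)
apply: (@le_trans _ _ (\prod_(i < r) \prod_(j < r | (i < j)%N)
   (C * (if i == Ordinal r0 then rate ^+ absz (k j - k (Ordinal r0)) else 1)))).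
  apply: ler_prod => i _; rewrite cabs_ge0 cabs_prod; apply: ler_prod => j _.
  rewrite cabs_ge0 /=; have := hC i (j, k i - k j);
    rewrite /= ler_pdivrMr ?exprn_gt0 // => h.
  apply: (le_trans h); apply: ler_wpM2l; first exact: ltW.
  case: eqP => [->|_]; first by rewrite distnC.
  by rewrite exprn_ile1 // ltW.
under eq_bigr do rewrite big_split /=.
rewrite big_split /= ler_wpM2l //.
  by apply: prodr_ge0 => i _; apply: prodr_ge0 => j _; apply: ltW.
rewrite (bigD1 (Ordinal r0)) //= ?eqxx [X in _ * X]big1 ?mulr1 => [|i /negPf ->]; last
  by rewrite big1.
rewrite le_eqVlt; apply/orP; left; apply/eqP; apply: eq_bigl => i.
by rewrite -val_eqE /= lt0n.
Qed.

Lemma armono_dominated : exists C : R, 0 < C /\ forall (L : nat) k, (absz (zsum k)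
  <= L)%N ->
  cabs (armono q z x k * tailpoch q a b z L (zsum k)) <= C * majorant k.
Proof.
have [/andP[rho0 rho1] haz hb] := rate_bounds.
have [C [C0 hC]] := pairs_bounded.
have [D [D0 hD]] := tail_bounded q0 q1 z0 rho0 haz hb.
exists (C * D); split=> [|L k kL]; first exact: mulr_gt0.
rewrite armono_factor //.
have -> (s p t u : R[i]) : s * p * t * u = s * (p * (t * u)) by rewrite !mulrA.
rewrite cabsM cabsXz cabsN cabs1 exp1rz mul1r cabsM.
apply: (le_trans (ler_pM (cabs_ge0 _) (cabs_ge0 _) (hC k) (hD L _ kL))).
rewrite le_eqVlt; apply/orP; left; apply/eqP; rewrite /majorant; ring.
Qed.

Lemma tailpoch_cvg (n : int) : ncvg (fun L => tailpoch q a b z L n)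
  (qpoch_inf q (a * q ^ (- n) + b) * (qpoch_inf q (z * q * (a + b * q ^ n)) * (1 - a
    * z))).
Proof.
have sub1 : forall N : nat, exists M : nat, forall L, (M <= L)%N -> leq N (absz
  (L%:Z + n)).
  by move=> N; exists (N + absz n)%N => L; lia.
have sub2 : forall N : nat, exists M : nat, forall L, (M <= L)%N -> leq N (absz
  (L%:Z - n)).
  by move=> N; exists (N + absz n)%N => L; lia.
have sub3 : forall N : nat, exists M : nat, forall L, (M <= L)%N -> leq N (absz
  (L%:Z - n)).-1.
  by move=> N; exists (N + absz n).+1 => L; lia.
apply: ncvgM; first exact: (ncvg_subseq sub1 (qpoch_cvg q1 _)).
set V := qpoch_inf _ _.
have -> : V * (1 - a * z) = V - z * a * (1 - 0) * V by ring.
apply: ncvgB; first exact: (ncvg_subseq sub2 (qpoch_cvg q1 _)).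
apply: ncvgM; last exact: (ncvg_subseq sub3 (qpoch_cvg q1 _)).
apply: ncvgM; first exact: ncvg_cst.
apply: ncvgB; first exact: ncvg_cst.
apply: (@ncvg_subseq _ (fun n => q ^+ n) 0 _ sub2); apply/ncvg_cabs => e e0.
have [N hN] := cabs_expq_small q1 1 e0; exists N => m /hN.
by rewrite mul1r sub0r cabsN cabsX.
Qed.

Lemma ncvg_cabs_le (u : nat -> R[i]) l (C : R) (N : nat) : ncvg u l ->
  (forall n, (N <= n)%N -> cabs (u n) <= C) -> cabs l <= C.
Proof.
move=> /ncvg_cabs ul uC; apply/ler_addgt0Pl => e /ul [M hM].
have := hM _ (leq_maxr N M); have := uC _ (leq_maxl N M).
have := cabsD (l - u (maxn N M)) (u (maxn N M)); rewrite subrK; lra.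
Qed.

Definition arsummand k := armono q z x k *
  (qpoch_inf q (a * q ^ (- zsum k) + b) * qpoch_inf q (z * q * (a + b * q ^ zsum k))).

(** The bound on the truncations is uniform in [L], so it passes to their limit, which is the
    summand times [1 - a z]. It supplies the majorant in the degenerate case. *)
Lemma arsummand_dominated : exists C : R, 0 < C /\ forall k, cabs (arsummand k) <= C
  * majorant k.
Proof.
have [C [C0 hC]] := armono_dominated.
have c0 : 0 < cabs (1 - a * z)^-1 by rewrite cabs_gt0 invr_eq0.
exists (cabs (1 - a * z)^-1 * C); split=> [|k]; first exact: mulr_gt0.
have h := ncvgM (@ncvg_cst _ (armono q z x k)) (@tailpoch_cvg (zsum k)).
have := ncvg_cabs_le h (hC^~ k).
rewrite [X in cabs X](_ : _ = arsummand k * (1 - a * z)); last by rewrite /arsummand;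
  ring.
move=> h2; rewrite -mulrA -[arsummand k](mulfK az1) cabsM mulrC.
by rewrite ler_wpM2l // ltW.
Qed.

Lemma majorant_bounded (C : R) : 0 <= C -> sumbounded (fun k => C * majorant k).
Proof.
have [h _ _] := rate_bounds.
by move=> C0; apply: sumboundedZ => //; apply: (sumbounded_kdiff h).
Qed.

Lemma qpoch_inf_eq0 (w : R[i]) n : w * q ^+ n = 1 -> qpoch_inf q w = 0.
Proof.
move=> wn; apply: qpoch_infE; apply: (@ncvg_eventually _ (fun=> 0) _ _ n.+1);
  last exact: ncvg_cst.
move=> m nm; rewrite /qpoch (bigD1 (Ordinal nm)) //= wn subrr mul0r //.
Qed.

Lemma has_sum_degenerate i j n : i != j -> x i * q ^+ n = x j -> has_sum arsummand 0.
Proof.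
move=> ij xij; have [C [C0 hC]] := arsummand_dominated.
apply: (has_sum_antisym (majorant_bounded (ltW C0)) hC (kswapK n ij)) => k.
by rewrite /arsummand armono_kswap // zsum_kswap // mulNr.
Qed.

Hypothesis xgen : forall i j n, i != j -> x i * q ^+ n != x j.

Lemma kshift_inj N : injective (@kshift r N).
Proof.
move=> c c' e; apply/ffunP => i; apply: val_inj.
have := congr1 (fun f : {ffun 'I_r -> int} => f i) e; rewrite !ffunE => /addIr; by case.
Qed.

Definition inbox (N : nat) k := [forall i, absz (k i) <= N]%N.

Lemma kshift_inbox N (c : {ffun 'I_r -> 'I_(N.*2).+1}) : inbox N (kshift c).
Proof. by apply/forallP => i; rewrite ffunE; have := ltn_ord (c i); lia. Qed.

Lemma inbox_kshift N k : inbox N k -> exists c : {ffun 'I_r -> 'I_(N.*2).+1}, k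
  = kshift c.
Proof.
move=> /forallP kN; exists [ffun i => inord (absz (k i + N%:Z))].
apply/ffunP => i; rewrite !ffunE; have := kN i; move: (k i) => t tN.
by rewrite inordK; lia.
Qed.

Lemma inbox_zsum N k : inbox N k -> (absz (zsum k) <= r * N)%N.
Proof.
move=> /forallP kN; have [|c ->] := @inbox_kshift N k; first exact/forallP.
by rewrite kshift_sum; have := ksum_le c; rewrite -doubleMr; lia.
Qed.

Definition macdonald : R[i] := \prod_(i < r) \prod_(j < r) qpoch_inf q (x i / x j * q).

Lemma q_not_unity n : q ^+ n.+1 != 1.
Proof.
apply/eqP => /(congr1 (@cabs R)); rewrite cabs1 cabsX => e.
by have := exprn_ilt1 n.+1 (cabs_ge0 q) q1; rewrite e ltxx.
Qed.

Lemma qpoch_ratio_neq0 i j : qpoch_inf q (x i / x j * q) != 0.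
Proof.
by apply: qpoch_inf_neq0 => // n; apply: gen_factor_neq0 => //; exact: q_not_unity.
Qed.

Lemma ipoch_cvg i j (f : nat -> nat) :
  (forall N : nat, exists M : nat, forall n, (M <= n)%N -> (N <= f n)%N) ->
  ncvg (fun N => ipoch q (x i / x j) (f N)) (qpoch_inf q (x i / x j * q))^-1.
Proof.
move=> hf; apply: ncvgV; first exact: qpoch_ratio_neq0.
exact: (ncvg_subseq hf (qpoch_cvg q1 _)).
Qed.

Lemma macdonaldC : \prod_(i < r) \prod_(j < r) qpoch_inf q (x j / x i * q) = macdonald.
Proof. by rewrite exchange_big. Qed.

Lemma macdonald_neq0 : macdonald != 0.
Proof. by apply/prodf_neq0 => i _; apply/prodf_neq0 => j _; apply: qpoch_ratio_neq0. Qed.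

Lemma arip_cvg k : ncvg (fun N => arip q x N k) (macdonald^-1 * macdonald^-1).
Proof.
have -> : macdonald^-1 * macdonald^-1 = \prod_(i < r) \prod_(j < r)
    ((qpoch_inf q (x j / x i * q))^-1 * (qpoch_inf q (x i / x j * q))^-1).
  rewrite -{1}macdonaldC /macdonald -!prodfV -big_split /=; apply: eq_bigr => i _.
  by rewrite -!prodfV -big_split.
apply: ncvg_prod => i; apply: ncvg_prod => j.
by apply: ncvgM; apply: ipoch_cvg => N; exists (N + absz (k i))%N => n; lia.
Qed.

Lemma arip_bounded : exists C : R, 0 < C /\ forall N k, cabs (arip q x N k) <= C.
Proof.
have [C [C0 hC]] : exists C : R, 0 < C /\ forall i (t : 'I_r * nat),
    cabs (ipoch q (x i / x t.1) t.2) <= C.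
  apply: uniform_bound => i.
  have [C [C0 hC]] : exists C : R, 0 < C /\ forall j (n : nat),
      cabs (ipoch q (x i / x j) n) <= C.
    apply: uniform_bound => j; apply: ipoch_bounded => // n.
    by apply: gen_factor_neq0 => //; exact: q_not_unity.
  by exists C; split=> // -[j d]; apply: hC.
exists (\prod_(i < r) \prod_(j < r) (C * C)); split=> [|N k].
  by apply: prodr_gt0 => i _; apply: prodr_gt0 => j _; apply: mulr_gt0.
rewrite cabs_prod; apply: ler_prod => i _; rewrite cabs_ge0 cabs_prod.
apply: ler_prod => j _; rewrite cabs_ge0 cabsM ler_pM ?cabs_ge0 //.
  exact: (hC j (i, _)).
exact: (hC i (j, _)).
Qed.

(** Extension by zero puts all truncations on the index set of the theorem, as [tannery]
    requires. *)
Definition boxterm (N : nat) k : R[i] :=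
  if inbox N k then armono q z x k * tailpoch q a b z (r * N) (zsum k) * arip q x N
    k else 0.

Lemma boxterm_sum N : exists s : seq {ffun 'I_r -> int},
  [/\ uniq s, forall k, k \notin s -> boxterm N k = 0 &
   \sum_(k <- s) boxterm N k = (\prod_i \prod_j ipoch q (x j / x i) N.*2)
    * (qpoch q (z * q) (r * N) * qpoch q z^-1 (r * N))].
Proof.
exists (map (@kshift r N) (enum {: {ffun 'I_r -> 'I_(N.*2).+1}})); split.
- by rewrite (map_inj_uniq (@kshift_inj N)) enum_uniq.
- move=> k; rewrite /boxterm; case: ifP => // /inbox_kshift[c ->].
  by rewrite map_f ?mem_enum.
- rewrite big_map big_enum -(ar_terminating q0 q_not_unity a b z0 x0 xgen) /=.
  by apply: eq_bigr => c _; rewrite /boxterm kshift_inbox.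
Qed.

Lemma boxterm_cvg k : ncvg (boxterm^~ k)
  (arsummand k * (1 - a * z) * (macdonald^-1 * macdonald^-1)).
Proof.
pose M := (\max_i absz (k i))%N.
apply: (@ncvg_eventually _ (fun N
  => armono q z x k * tailpoch q a b z (r * N) (zsum k) * arip q x N k) _ _ M).
  move=> N MN; rewrite /boxterm ifT //; apply/forallP => i.
  by apply: leq_trans MN; apply: (leq_bigmax (F := fun i => absz (k i))).
apply: ncvgM; last exact: arip_cvg.
have -> : arsummand k * (1 - a * z) = armono q z x k *
    (qpoch_inf q (a * q ^ (- zsum k) + b) *
     (qpoch_inf q (z * q * (a + b * q ^ zsum k)) * (1 - a * z))).
  by rewrite /arsummand; ring.
apply: ncvgM; first exact: ncvg_cst.
apply: (@ncvg_subseq _ (fun L => tailpoch q a b z L (zsum k)) _ (fun N => r * N)%N);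
  last first.
  exact: tailpoch_cvg.
by move=> N; exists N => n Nn; rewrite (leq_trans Nn) // leq_pmull.
Qed.

Lemma has_sum_generic : has_sum arsummand
  (qpoch_inf q (z * q) * qpoch_inf q z^-1 / (1 - a * z) * macdonald).
Proof.
have [C [C0 hC]] := armono_dominated; have [D [D0 hD]] := arip_bounded.
(* [c] undoes the factor [(1 - a z) / macdonald^2] by which the limit of [boxterm] differs from the
   summand. *)
have P0 := macdonald_neq0; pose c := macdonald * macdonald / (1 - a * z).
pose B := cabs c * C * D.
have B0 : 0 <= B by rewrite !mulr_ge0 ?cabs_ge0 // ltW.
apply: (@tannery _ _ (fun k => B * majorant k) arsummand (fun N k => c * boxterm N k)
  (fun N => c * ((\prod_i \prod_j ipoch q (x j / x i) N.*2)
    * (qpoch q (z * q) (r * N) * qpoch q z^-1 (r * N))))).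
- exact: majorant_bounded.
- move=> N k; rewrite cabsM /boxterm; case: ifP => kN; last first.
    by rewrite cabs0 mulr0 mulr_ge0 // majorant_ge0.
  have -> : B * majorant k = cabs c * (C * majorant k * D) by rewrite /B; ring.
  rewrite ler_wpM2l ?cabs_ge0 // cabsM.
  by rewrite ler_pM ?cabs_ge0 // hC // inbox_zsum.
- move=> k; have -> : arsummand k
  = c * (arsummand k * (1 - a * z) * (macdonald^-1 * macdonald^-1)).
    by rewrite /c; field; rewrite P0 az1.
  by apply: ncvgM; [exact: ncvg_cst|exact: boxterm_cvg].
- move=> N; have [s [us s0 sE]] := boxterm_sum N; exists s; split=> //.
    by move=> k /s0 ->; rewrite mulr0.
  by rewrite -mulr_sumr sE.
have -> : qpoch_inf q (z * q) * qpoch_inf q z^-1 / (1 - a * z) * macdonald =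
    c * (macdonald^-1 * (qpoch_inf q (z * q) * qpoch_inf q z^-1)).
  by rewrite /c; field; rewrite P0 az1.
apply: ncvgM; first exact: ncvg_cst.
have sub : forall N : nat, exists M : nat, forall n, (M <= n)%N -> (N <= r * n)%N.
  by move=> N; exists N => n Nn; rewrite (leq_trans Nn) // leq_pmull.
apply: ncvgM; last first.
  by apply: ncvgM; apply: (ncvg_subseq sub (qpoch_cvg q1 _)).
rewrite -macdonaldC -prodfV; apply: ncvg_prod => i; rewrite -prodfV; apply: ncvg_prod
  => j.
by apply: ipoch_cvg => N; exists N => n; lia.
Qed.
End MainSum.

(** * The identity for arbitrary distinct nonzero parameters *)

Local Open Scope complex_scope.

Theorem theorem5p3 (R : realType) (r : nat) (hr : (0 < r)%N)
    (q a b z : R[i]) (x : 'I_r -> R[i])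
    (hq0 : 0 < `|q|) (hq1 : `|q| < 1)
    (hz : z != 0) (haz : a * z != 1)
    (hab : Num.max `|a * z| `|b| < 1)
    (hx0 : forall i : 'I_r, x i != 0)
    (hx : forall i j : 'I_r, i != j -> x i != x j) :
  has_sum
    (fun k : {ffun 'I_r -> int} =>
       (\prod_(i < r) \prod_(j < r | (i < j)%N)
          ((x i * q ^ k i - x j * q ^ k j) / (x i - x j)))
       * qpoch_inf q (a * q ^ (- zsum k) + b)
       * qpoch_inf q (z * q * (a + b * q ^ zsum k))
       * (-1) ^ (r%:Z * zsum k)
       * q ^ (zsum k + r%:Z * \sum_(i < r) zbin2 (k i))
       * z ^ zsum k
       * \prod_(i < r) x i ^ (r%:Z * k i - zsum k))
    (qpoch_inf q (z * q) * qpoch_inf q z^-1 / (1 - a * z)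
     * \prod_(i < r) \prod_(j < r) qpoch_inf q (x i / x j * q)).
Proof.
have q0 : q != 0 by rewrite -normr_gt0.
have q1 : cabs q < 1 by move: hq1; rewrite cabsE (ltcR _ 1).
have az1 : 1 - a * z != 0 by rewrite subr_eq0 eq_sym.
have [az_lt1 b_lt1] : cabs (a * z) < 1 /\ cabs b < 1.
  (* The order on [R[i]] is partial, so the maximum is unfolded to its defining test, which for
     norms is a comparison of real numbers. *)
  move: hab; rewrite !cabsE /Num.max ltcR; case: ltP => h; rewrite (ltcR _ 1) => h1.
    by split=> //; apply: lt_trans h1.
  by split=> //; apply: le_lt_trans h1.
rewrite (_ : (fun k : {ffun 'I_r -> int} => _) = arsummand q a b z x); last first.
  by apply/funext => k; rewrite /arsummand /armono; ring.
have [[i [j [n [ij xij]]]]|gen] :=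
    pselect (exists i j n, i != j /\ x i * q ^+ n = x j); last first.
  apply: has_sum_generic => // i j n ij; apply/eqP => e; apply: gen.
  by exists i, j, n.
rewrite (bigD1 i) //= (bigD1 j) //=.
(* Distinctness rules out exponent zero. With exponent [n + 1], the factor of index [n] in the
   Pochhammer symbol of [q x i / x j] is zero, and so is the whole right-hand side. *)
case: n xij => [|n] xij; first by move: (hx i j ij); rewrite -xij expr0 mulr1 eqxx.
have -> : qpoch_inf q (x i / x j * q) = 0.
  apply: (@qpoch_inf_eq0 _ _ _ n); rewrite -mulrA -exprS mulrAC xij divff //.
rewrite !mul0r mulr0; exact: (has_sum_degenerate hr q0 q1 hz az1 az_lt1 b_lt1 hx0 ij xij).
Qed.
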